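(* Let $f_1,\ldots,f_{\mathrm{rk}(G)}$ be algebraically independent homogeneous generators of $\mathbb{C}[\mathfrak{g}]^G$. Let $y\in\mathfrak{g}_{\mathrm{reg}}$, and let $\{\theta_1,\ldots,\theta_{\dim(G)}\}$ be a basis of $\mathfrak{g}^*$, viewed as a system of global holomorphic coordinates on $\mathfrak{g}$, ordered so that the $\mathrm{rk}(G)\times\mathrm{rk}(G)$ matrix $$\left(\frac{\partial f_i}{\partial\theta_j}(y)\right)_{1\le i,j\le \mathrm{rk}(G)}$$ has nonzero determinant. Let $\Phi:G\times S_{\mathrm{reg}}\to\mathfrak{g}$ be given by $\Phi(g,x)=-\mathrm{Ad}_{g^{-1}}(x)$, and define holomorphic functions $\Phi_1,\ldots,\Phi_{\dim(G)}:G\times S_{\mathrm{reg}}\to\mathbb{C}$ by $$\Phi_i=\begin{cases} f_i\circ\Phi & \text{if } i=1,\ldots,\mathrm{rk}(G),\\ \theta_i\circ\Phi & \text{if } i=\mathrm{rk}(G)+1,\ldots,\dim(G).\end{cases}$$ Then the functions $\Phi_i$ form an integrable system on $G\times S_{\mathrm{reg}}$, and the rank of this system is $\mathrm{rk}(G)$.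
   Context: $G$ is a connected, simply-connected, complex semisimple linear algebraic group of rank $\mathrm{rk}(G)$, with Lie algebra $\mathfrak{g}$, Killing form $\langle\cdot,\cdot\rangle$, and adjoint representation $\mathrm{Ad}$. $\mathbb{C}[\mathfrak{g}]=\mathrm{Sym}(\mathfrak{g}^* )$ is the algebra of polynomial functions on $\mathfrak{g}$ and $\mathbb{C}[\mathfrak{g}]^G$ its subalgebra of $\mathrm{Ad}$-invariant polynomials; it is known to be generated by $\mathrm{rk}(G)$ algebraically independent homogeneous elements. For $x\in\mathfrak{g}$, $Z_{\mathfrak{g}}(x)=\{y\in\mathfrak{g}:[x,y]=0\}$; $\mathfrak{g}_{\mathrm{reg}}=\{x\in\mathfrak{g}:\dim Z_{\mathfrak{g}}(x)=\mathrm{rk}(G)\}$ (not assumed semisimple). It is known (Kostant) that $\mathfrak{g}_{\mathrm{reg}}$ is exactly the locus where $df_1,\ldots,df_{\mathrm{rk}(G)}$ are linearly independent, so for every $y\in\mathfrak{g}_{\mathrm{reg}}$ any basis of $\mathfrak{g}^*$ can be reordered as required. There is exactly one nilpotent adjoint orbit consisting of regular elements, denoted $\mathcal{O}_{\mathrm{reg}}$. Fix a regular $\mathfrak{sl}_2(\mathbb{C})$-triple $(\xi,h,\eta)$ in $\mathfrak{g}$, i.e. $[\xi,\eta]=h$, $[h,\xi]=2\xi$, $[h,\eta]=-2\eta$ with $\xi,\eta\in\mathcal{O}_{\mathrm{reg}}$; the associated Slodowy slice is $S_{\mathrm{reg}}:=\xi+Z_{\mathfrak{g}}(\eta)\subseteq\mathfrak{g}$.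 $G\times\mathfrak{g}$ carries the holomorphic symplectic form $$\omega_{(g,x)}\big((d_eR_g(y_1),z_1),(d_eR_g(y_2),z_2)\big)=\langle y_1,z_2\rangle-\langle y_2,z_1\rangle-\langle x,[y_1,y_2]\rangle,\quad y_1,y_2,z_1,z_2\in\mathfrak{g},$$ where $R_g$ is right multiplication by $g$. The holomorphic symplectic form on $G\times S_{\mathrm{reg}}$ is the restriction of $\omega$ (known, by Bielawski, to be symplectic). Definition: on an $n$-dimensional holomorphic symplectic manifold $X$ with induced Poisson bracket $\{\cdot,\cdot\}$, an integrable system of (fixed) rank $r$ consists of holomorphic functions $F_1,\ldots,F_{n-r}:X\to\mathbb{C}$ such that $r\le n/2$; $\{F_i,F_j\}=0$ for all $i\in\{1,\ldots,r\}$ and $j\in\{1,\ldots,n-r\}$; and $dF_1,\ldots,dF_{n-r}$ are linearly independent at each point of an open dense subset of $X$. *)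

(* Defs.v *)
(* A linear algebraic group is a Zariski-closed subgroup G of GL_n(C), with Lie
   algebra g inside 'M_n(C); manifolds are submanifolds of the normed space
   'M_n(C) * 'M_n(C), and functions on them are functions on that space of
   which only the values on the submanifold matter. *)
From HB Require Import structures.
From mathcomp Require Import all_boot all_order all_algebra complex.
From mathcomp Require Import all_classical all_reals all_analysis.
(* mpoly's notations clash with those of MathComp-Analysis. *)
From mathcomp Require Import (canonicals, coercions) mpoly.

Set Implicit Arguments.
Unset Strict Implicit.
Unset Printing Implicit Defensive.

Import Order.TTheory GRing.Theory Num.Theory.
Import numFieldNormedType.Exports.

Local Open Scope classical_set_scope.
Local Open Scope ring_scope.

(* Packing R[i] as a numClosedFieldType gives it, and the matrices over it,
   the topology and norm of MathComp-Analysis. *)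
Definition Cplx (R : realType) : numClosedFieldType := R[i].

Section Groups.
Context {R : realType} {n : nat}.
Local Notation C := (Cplx R).
Local Notation M := 'M[C]_n.

Definition lie (x y : M) : M := x *m y - y *m x.

Definition ad (x : M) : 'End(M) := linfun (mulmx x) - linfun (mulmxr x).

Definition Ad (a x : M) : M := a *m x *m invmx a.

Definition entry_poly := mpoly.mpoly (n * n) C.

Definition eval_entries (p : entry_poly) (a : M) : C :=
  mpoly.meval (fun k => mxvec a 0 k) p.

Definition linear_algebraic_group (G : set M) : Prop :=
  [/\ exists I : set entry_poly,
        G = [set a | a \in unitmx /\ forall p, I p -> eval_entries p a = 0],
      G 1%:M,
      forall a b, G a -> G b -> G (a *m b) &
      forall a, G a -> G (invmx a)].

(* The Zariski tangent space of G at 1: the differential at 1 of each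
   polynomial vanishing on G kills it. *)
Definition lie_algebra_of (G : set M) (g : {vspace M}) : Prop :=
  forall X : M, X \in g <->
    forall p : entry_poly, (forall a, G a -> eval_entries p a = 0) ->
      \sum_k eval_entries (mpoly.mderiv k p) 1%:M * mxvec X 0 k = 0.

(* Every loop in A is null-homotopic in A relative to its base point. *)
Definition loops_contractible (A : set M) : Prop :=
  let I : set R := `[0, 1]%classic in
  forall gamma : R -> M,
    {within I, continuous gamma} -> (forall t, I t -> A (gamma t)) ->
    gamma 0 = gamma 1 ->
    exists H : R * R -> M,
      [/\ {within I `*` I, continuous H},
          forall s t, I s -> I t -> A (H (s, t)),
          forall t, I t -> H (0, t) = gamma t /\ H (1, t) = gamma 0 &
          forall s, I s -> H (s, 0) = gamma 0 /\ H (s, 1) = gamma 0].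

(* Connectedness is that of the classical topology, which for complex
   algebraic groups agrees with Zariski connectedness. *)
Definition simply_connected (A : set M) : Prop :=
  connected A /\ loops_contractible A.

Definition commutator_space (U V : {vspace M}) : {vspace M} :=
  <<[seq lie u v | u <- vbasis U, v <- vbasis V]>>%VS.

Definition lie_ideal (g I : {vspace M}) : Prop :=
  (I <= g)%VS /\ (commutator_space g I <= I)%VS.

Definition lie_solvable (I : {vspace M}) : Prop :=
  exists k, iter k (fun U => commutator_space U U) I = 0%VS.

(* the radical of g vanishes *)
Definition semisimple_lie_algebra (g : {vspace M}) : Prop :=
  forall I, lie_ideal g I -> lie_solvable I -> I = 0%VS.

Definition torus (T : set M) : Prop :=
  [/\ linear_algebraic_group T, connected T &
      exists2 P : M, P \in unitmx & forall t, T t -> is_diag_mx (Ad P t)].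

Definition maximal_torus (G T : set M) : Prop :=
  [/\ torus T, T `<=` G &
      forall T', torus T' -> T' `<=` G -> T `<=` T' -> T' = T].

Definition group_rank (G : set M) (r : nat) : Prop :=
  exists T t, [/\ maximal_torus G T, lie_algebra_of T t & \dim t = r].

Definition centralizer (g : {vspace M}) (x : M) : {vspace M} :=
  (g :&: lker (ad x))%VS.

(* r stands for the rank of the group *)
Definition regular (g : {vspace M}) (r : nat) (x : M) : Prop :=
  x \in g /\ \dim (centralizer g x) = r.

Definition nilpotent_elt (g : {vspace M}) (x : M) : Prop :=
  x \in g /\ exists k, forall y, y \in g -> iter k (lie x) y = 0.

Definition regular_nilpotent_orbit (G : set M) (g : {vspace M}) (r : nat)
    (O : set M) : Prop :=
  (exists2 x, x \in g & O = [set Ad a x | a in G]) /\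
  (forall x, O x -> nilpotent_elt g x /\ regular g r x).

Definition sl2_triple (g : {vspace M}) (xi h eta : M) : Prop :=
  [/\ [/\ xi \in g, h \in g & eta \in g],
      lie xi eta = h, lie h xi = 2%:R *: xi & lie h eta = - (2%:R *: eta)].

Definition slodowy_slice (g : {vspace M}) (xi eta : M) : set M :=
  [set x | x - xi \in centralizer g eta].

(* the trace of ad x \o ad y on g, in the basis vbasis g *)
Definition killing (g : {vspace M}) (x y : M) : C :=
  \sum_(i < \dim g) coord (vbasis g) i (lie x (lie y (vbasis g)`_i)).

End Groups.

Section PolynomialFunctions.
Context {R : realType} {n : nat}.
Local Notation C := (Cplx R).
Local Notation M := 'M[C]_n.
Variable g : {vspace M}.
Local Notation gT := (subvs_of g).

Definition polyfun (p : mpoly.mpoly (\dim g) C) : gT -> C :=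
  fun x => mpoly.meval (fun i => coord (vbasis g) i (vsval x)) p.

Definition invariant_polyfun (G : set M) (F : gT -> C) : Prop :=
  (exists p, F = polyfun p) /\
  (forall a x, G a -> F (vsproj g (Ad a (vsval x))) = F x).

Definition homogeneous_polyfun (F : gT -> C) : Prop :=
  exists k p, p \is mpoly.ishomog1 k mpoly.mdeg /\ F = polyfun p.

Definition subst_polyfun r (q : mpoly.mpoly r C) (f : 'I_r -> gT -> C) :
    gT -> C :=
  fun x => mpoly.meval (fun i => f i x) q.

Definition algebraically_independent r (f : 'I_r -> gT -> C) : Prop :=
  forall q : mpoly.mpoly r C, (forall x, subst_polyfun q f x = 0) -> q = 0.

Definition homogeneous_free_generators (G : set M) r (f : 'I_r -> gT -> C) :
    Prop :=
  [/\ forall i, invariant_polyfun G (f i),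
      forall i, homogeneous_polyfun (f i),
      algebraically_independent f &
      forall F, invariant_polyfun G F ->
        exists q : mpoly.mpoly r C, F = subst_polyfun q f].

Definition covector := 'Hom(gT, C^o).

(* The j-th vector of the basis of g dual to theta; 0 when j >= \dim g. *)
Definition dual_basis_vector (theta : (\dim g).-tuple covector) (j : nat) :
    gT :=
  xget 0 [set v | forall k : 'I_(\dim g),
                    tnth theta k v = (k == j :> nat)%:R :> C].

(* In the coordinates theta, increasing the j-th coordinate alone is moving
   along the j-th vector of the dual basis. *)
Definition partial_derivative (theta : (\dim g).-tuple covector)
    (F : gT -> C) (j : nat) (y : gT) : C :=
  derive1 (fun t : C => F (y + t *: dual_basis_vector theta j)) 0.

End PolynomialFunctions.

Section IntegrableSystems.
Context {R : realType} {n : nat}.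
Local Notation C := (Cplx R).
Local Notation E := ('M[C]_n * 'M[C]_n)%type.

(* First-order expansion of F at p along X.  Only the restriction of l to the
   tangent space of X at p is determined by F. *)
Definition is_differential (X : set E) (F : E -> C) (p : E)
    (l : 'Hom(E, C^o)) : Prop :=
  forall e : C, 0 < e ->
    \forall q \near within X (nbhs p),
      `|F q - F p - l (q - p)| <= e * `|q - p|.

Definition hamiltonian_vector (T : {vspace E}) (om : E -> E -> C)
    (l : 'Hom(E, C^o)) (v : E) : Prop :=
  v \in T /\ forall w, w \in T -> om v w = l w.

(* c is the value of the bracket of two functions with differentials l1, l2
   at the given point; the Hamiltonian vectors are required to exist. *)
Definition poisson_bracket_value (T : {vspace E}) (om : E -> E -> C)
    (l1 l2 : 'Hom(E, C^o)) (c : C) : Prop :=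
  exists v1 v2, [/\ hamiltonian_vector T om l1 v1,
    hamiltonian_vector T om l2 v2 & c = om v1 v2].

Definition independent_on (T : {vspace E}) m (l : 'I_m -> 'Hom(E, C^o)) :
    Prop :=
  forall c : 'I_m -> C,
    (forall v, v \in T -> \sum_i c i * l i v = 0) -> forall i, c i = 0.

(* F is an integrable system of rank r on the d-dimensional submanifold X,
   with tangent spaces T and symplectic form om.  F_1, ..., F_r are the F i
   with i < r.  Holomorphy of F is complex differentiability along X at each
   of its points. *)
Definition integrable_system (X : set E) (T : E -> {vspace E})
    (om : E -> E -> E -> C) (d r m : nat) (F : 'I_m -> E -> C) : Prop :=
  [/\ forall p, X p -> \dim (T p) = d,
      (r.*2 <= d)%N, m = (d - r)%N &
      exists dF : 'I_m -> E -> 'Hom(E, C^o),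
      [/\ forall i p, X p -> is_differential X (F i) p (dF i p),
          forall (i j : 'I_m) p, (i < r)%N -> X p ->
            poisson_bracket_value (T p) (om p) (dF i p) (dF j p) 0 &
          exists U : set E, [/\ open U, X `<=` closure (X `&` U) &
            forall p, X p -> U p -> independent_on (T p) (dF ^~ p)]]].

End IntegrableSystems.

Section PhaseSpace.
Context {R : realType} {n : nat}.
Local Notation C := (Cplx R).
Local Notation M := 'M[C]_n.
Local Notation E := (M * M)%type.

(* The tangent vectors at (a, x) are the (y a, z) with y in g and z in the
   centralizer of eta; y a is the image of y under the differential at 1 of
   right multiplication by a. *)
Definition phase_tangent (g : {vspace M}) (eta : M) (p : E) : {vspace E} :=
  (linfun (fun y : M => (y *m p.1, 0 : M)) @: g +
   linfun (fun z : M => (0 : M, z)) @: centralizer g eta)%VS.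

Definition phase_form (g : {vspace M}) (p u v : E) : C :=
  let y1 := u.1 *m invmx p.1 in
  let y2 := v.1 *m invmx p.1 in
  killing g y1 v.2 - killing g y2 u.2 - killing g p.2 (lie y1 y2).

Definition Phi (p : E) : M := - Ad (invmx p.1) p.2.

Definition Phi_component (g : {vspace M}) r
    (f : 'I_r -> subvs_of g -> C) (theta : (\dim g).-tuple (covector g))
    (i : 'I_(\dim g)) (p : E) : C :=
  let x := vsproj g (Phi p) in
  if insub (i : nat) is Some k then f k x else tnth theta i x.

End PhaseSpace.

(* Main.v *)
(* On the tangent vector (y a, z) of the phase space at (a, x), the differential
   of Phi is - Ad_{a^-1} (z + [x, y]).  Hence a function H o Phi has the
   Hamiltonian vector (u a, 0), where u is the Killing gradient of
   w |-> - dH (Ad_{a^-1} w); for two such functions the bracket is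
   - <[x, u1], u2>, and [x, u1] = 0 when H is invariant.  Gradients exist by
   Cartan's criterion.

   The differentials are independent where a polynomial D does not vanish at
   Phi (a, x) and Z_g(eta) is a complement of [x, g].  This locus is dense.
   Locally vanishing regular functions on the connected group G vanish, so it is
   enough that D o Phi is not identically zero.  The polynomials P with
   P o Phi = 0 are stable under partial derivatives because Phi is a submersion
   wherever Z_g(eta) complements [x, g], so by Taylor expansion P = 0. *)
Require Import Defs.
From HB Require Import structures.
From mathcomp Require Import all_boot all_order all_algebra complex.
From mathcomp Require Import all_classical all_reals all_analysis.
From mathcomp Require Import ring.
From mathcomp Require Import (canonicals, coercions) mpoly.

Set Implicit Arguments.
Unset Strict Implicit.
Unset Printing Implicit Defensive.

Import Order.TTheory GRing.Theory Num.Theory.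
Import numFieldNormedType.Exports.

Local Open Scope classical_set_scope.
Local Open Scope ring_scope.

(* Otherwise unification unfolds [Cplx R] to [R[i]], whose instances are not
   syntactically those of an abstract numClosedFieldType. *)
Opaque Cplx.

(** * The conjugate part of a matrix *)

(** Semisimplicity is given as vanishing of the radical, so nondegeneracy of the Killing form has to
    be earned: the kernel of the form is an ideal, its derived series stabilises at a perfect L, the
    conjugate part makes L act nilpotently on g, and Engel's theorem forces L = 0. As g is the
    Zariski tangent space of G at 1, derivatives along G come from translating functions that vanish
    on G back to 1 rather than from an exponential map; this yields both that g is a subalgebra and
    that differentials of invariants at x kill [x, g]. The identity theorem on G likewise works
    without charts, in finite-dimensional spaces of functions stable under translation. That
    Z_g(eta) complements [xi, g] follows from a weight argument fed by nilpotency of ad xi and from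
    a dimension count with dim Z_g(xi) = dim Z_g(eta) = r; it persists where a polynomial delta does
    not vanish. The polynomial D is the Jacobian of the f_i along the basis dual to theta, nonzero
    at y by hypothesis. Placing y in the image of Phi would take Kostant's theorem on slices;
    dominance of Phi replaces it. *)

(** Chinese remainders by induction: with [u * p + v * (X - a)^m = 1], adding [u * (c a - q) * p]
    corrects [q] at [a] and changes nothing modulo the factors of [p]. Contact to order [m] makes
    [q(A)] act as the scalar [c a] on vectors killed by [(A - a)^m]. *)
Lemma hermite_interpolation (F : fieldType) (c : F -> F) (m : nat) (s : seq F) :
  uniq s ->
  exists q : {poly F}, forall a, a \in s -> ('X - a%:P) ^+ m %| q - (c a)%:P.
Proof.
elim: s => [|a s IH] /=; first by exists 0.
case/andP=> nas us; have [q qP] := IH us.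
pose p : {poly F} := \prod_(b <- s) ('X - b%:P) ^+ m.
have cop : coprimep p (('X - a%:P) ^+ m).
  rewrite /p big_seq; elim/big_rec: _ => [|b x bs cx]; first exact: coprime1p.
  rewrite coprimepMl cx andbT coprimep_expl// coprimep_expr//.
  by rewrite coprimep_XsubC root_XsubC; apply: contraNneq nas => ->.
have [[u v] /= uvP] := Bezout_eq1_coprimepP _ _ cop.
exists (q + u * ((c a)%:P - q) * p) => b; rewrite inE => /predU1P[->|bs].
  rewrite (_ : q + _ - _ = (q - (c a)%:P) * (1 - u * p)); last by ring.
  by rewrite -uvP addrAC subrr add0r dvdp_mull// dvdp_mull.
by rewrite addrAC dvdp_add ?qP// dvdp_mull// /p (big_rem b)//= dvdp_mulr.
Qed.

(** Primary decomposition as an induction principle: coprime factors split the kernel of their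
    product, so an additive property has only to be checked on vectors killed by a single power. *)
Lemma prod_root_pow_ind (F : fieldType) n (A : 'M[F]_n.+1) (m : nat)
    (s : seq F) (Q : 'rV[F]_n.+1 -> Prop) :
    uniq s -> Q 0 ->
    (forall u v, Q u -> Q v -> Q (u + v)) ->
    (forall a u, a \in s -> u *m (A - a%:M) ^+ m = 0 -> Q u) ->
  forall u, u *m horner_mx A (\prod_(a <- s) ('X - a%:P) ^+ m) = 0 -> Q u.
Proof.
move=> + Q0 QD; elim: s => [|a s IH] /=.
  by move=> _ _ u; rewrite big_nil rmorph1 mulmx1 => ->.
case/andP=> nas us Qs u; rewrite big_cons => /eqP.
rewrite -sub_kermx.
have cop : coprimep (('X - a%:P) ^+ m) (\prod_(b <- s) ('X - b%:P) ^+ m).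
  rewrite coprimep_sym.
  rewrite big_seq; elim/big_rec: _ => [|b x bs cx]; first exact: coprime1p.
  rewrite coprimepMl cx andbT coprimep_expl// coprimep_expr//.
  by rewrite coprimep_XsubC root_XsubC; apply: contraNneq nas => ->.
rewrite -/(kermxpoly _ _) (kermxpolyM _ cop).
case/sub_addsmxP=> [[u1 u2] /= ->]; apply: QD.
  apply: (Qs a); first by rewrite mem_head.
  apply/eqP; rewrite -sub_kermx.
  have := submxMl u1 (kermxpoly A (('X - a%:P) ^+ m)).
  by rewrite {2}/kermxpoly rmorphXn rmorphB/= horner_mx_X horner_mx_C.
apply: IH => // [b v bs|]; first by apply: Qs; rewrite inE bs orbT.
by apply/eqP; rewrite -sub_kermx; apply: submxMl.
Qed.

Lemma trig_mul_diag (R : comNzRingType) n (A B : 'M[R]_n) :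
  is_trig_mx A -> is_trig_mx B ->
  is_trig_mx (A *m B) /\ forall i, (A *m B) i i = A i i * B i i.
Proof.
move=> /is_trig_mxP tA /is_trig_mxP tB; split.
  apply/is_trig_mxP => i j ij; rewrite mxE big1// => k _.
  have [ik|ki] := ltnP i k; first by rewrite tA// mul0r.
  by rewrite tB ?mulr0// (leq_ltn_trans ki).
move=> i; rewrite mxE (bigD1 i)//= big1 ?addr0// => k ki.
have [ik|{}ki'] := ltnP i k; first by rewrite tA// mul0r.
by rewrite tB ?mulr0// ltn_neqAle ki'  andbT.
Qed.

Lemma trig_horner_diag (R : comNzRingType) n (A : 'M[R]_n.+1) (q : {poly R}) :
  is_trig_mx A ->
  is_trig_mx (horner_mx A q) /\ forall i, (horner_mx A q) i i = q.[A i i].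
Proof.
move=> tA; elim/poly_ind: q => [|q c [tq dq]].
  rewrite rmorph0; split=> [|i]; last by rewrite mxE horner0.
  by apply/is_trig_mxP=> i j _; rewrite mxE.
rewrite rmorphD rmorphM/= horner_mx_X horner_mx_C.
have [tM dM] := trig_mul_diag tq tA; split.
  apply/is_trig_mxP => i j ij; rewrite mxE (is_trig_mxP tM)// mxE.
  by rewrite -val_eqE /= ltn_eqF ?mulr0n ?addr0.
by move=> i; rewrite mxE dM dq !hornerE mxE eqxx.
Qed.

Section ConjugatePart.
Variables (C : numClosedFieldType).

(** In triangular form the diagonal of [A q(A)] consists of the [|a|^2], so a zero trace makes every
    eigenvalue vanish, and Cayley-Hamilton concludes. *)
Lemma trace_mul_conj_nilpotent n (A : 'M[C]_n.+1) (q : {poly C}) :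
    (forall a, root (char_poly A) a -> q.[a] = a^*) ->
  \tr (A *m horner_mx A q) = 0 -> A ^+ n.+1 = 0.
Proof.
move=> qP.
have [P Pu] := Schur A isT; rewrite /similar_to conjumx ?unitarymx_unit// => tT.
have uP := unitarymx_unit Pu.
set T := P *m A *m invmx P in tT.
have rootT a : root (char_poly T) a -> root (char_poly A) a.
  rewrite -!eigenvalue_root_char => /eigenvalueP[v vT v0].
  apply/eigenvalueP; exists (v *m P).
    by rewrite -mulmxA -[P *m A](mulmxKV uP) -/T mulmxA vT scalemxAl.
  by apply: contraNneq v0 => vP; rewrite -[v](mulmxK uP) vP mul0mx.
have TE p : horner_mx T p = P *m horner_mx A p *m invmx P.
  exact: horner_mx_uconj.
move=> tr0.
have diag0 i : T i i = 0.
  have [tq dq] := trig_horner_diag ('X * q) tT.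
  have : \tr (horner_mx T ('X * q)) = 0.
    by rewrite TE mxtrace_mulC mulKmx// rmorphM/= horner_mx_X.
  rewrite /mxtrace => /eqP; rewrite psumr_eq0.
    move=> /allP /(_ i (mem_index_enum i)) /=; rewrite dq hornerM hornerX qP.
      by rewrite -normCK expf_eq0 /= normr_eq0 => /eqP.
    apply: rootT; rewrite (char_poly_trig tT) (bigD1 i)//=.
    by rewrite rootM root_XsubC eqxx.
  move=> j _; rewrite dq hornerM hornerX qP -?normCK ?exprn_ge0//.
  apply: rootT; rewrite (char_poly_trig tT) (bigD1 j)//=.
  by rewrite rootM root_XsubC eqxx.
have Tn : horner_mx T ('X ^+ n.+1) = 0.
  rewrite -(Cayley_Hamilton T) (char_poly_trig tT); congr horner_mx.
  under eq_bigr do rewrite diag0 subr0.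
  by rewrite prodr_const card_ord.
have : horner_mx A ('X ^+ n.+1) = 0.
  by rewrite -[LHS](mulKmx uP) -[P *m _](mulmxKV uP) -TE Tn mul0mx mulmx0.
by rewrite rmorphXn /= horner_mx_X.
Qed.

Definition derivation n (B : 'rV[C]_n -> 'rV[C]_n -> 'rV[C]_n) (A : 'M[C]_n) :=
  forall u v, B u v *m A = B (u *m A) v + B u (v *m A).

Section Derivation.
Variables (n : nat) (B : 'rV[C]_n.+1 -> 'rV[C]_n.+1 -> 'rV[C]_n.+1).
Hypotheses (Bl : forall v, linear (B^~ v)) (Br : forall u, linear (B u)).

Let Bl' v : {linear 'rV[C]_n.+1 -> 'rV[C]_n.+1} :=
  HB.pack (B^~ v) (GRing.isLinear.Build _ _ _ _ (B^~ v) (Bl v)).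
Let Br' u : {linear 'rV[C]_n.+1 -> 'rV[C]_n.+1} :=
  HB.pack (B u) (GRing.isLinear.Build _ _ _ _ (B u) (Br u)).

Let Bl0 v : B 0 v = 0. Proof. exact: (linear0 (Bl' v)). Qed.
Let Br0 u : B u 0 = 0. Proof. exact: (linear0 (Br' u)). Qed.
Let BlD u1 u2 v : B (u1 + u2) v = B u1 v + B u2 v.
Proof. exact: (linearD (Bl' v)). Qed.
Let BrD u v1 v2 : B u (v1 + v2) = B u v1 + B u v2.
Proof. exact: (linearD (Br' u)). Qed.
Let BlZ a u v : B (a *: u) v = a *: B u v.
Proof. exact: (linearZ_LR (Bl' v)). Qed.
Let BrZ a u v : B u (a *: v) = a *: B u v.
Proof. exact: (linearZ_LR (Br' u)). Qed.

(** Applying [A - (a + b)] to [B u v] gives a sum of two terms, each with one exponent lowered; a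
    term dies once either exponent is exhausted. *)
Lemma derivation_geigen (A : 'M[C]_n.+1) a b k l u v :
  derivation B A ->
  u *m (A - a%:M) ^+ k = 0 -> v *m (A - b%:M) ^+ l = 0 ->
  B u v *m (A - (a + b)%:M) ^+ (k + l) = 0.
Proof.
move=> dB; move kl: (k + l)%N => m.
elim: m k l u v kl => [|m IH] [|k] [|l] u v //.
- by move=> _; rewrite expr0 !mulmx1 => -> _; rewrite Bl0.
- by move=> _; rewrite expr0 mulmx1 => -> _; rewrite Bl0 mul0mx.
- by move=> _ _; rewrite expr0 mulmx1 => ->; rewrite Br0 mul0mx.
move=> [kl]; rewrite !exprS => uA vA.
rewrite mulmxA.
have -> : B u v *m (A - (a + b)%:M) =
    B (u *m (A - a%:M)) v + B u (v *m (A - b%:M)).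
  rewrite !mulmxBr dB !mul_mx_scalar.
  rewrite -![- (_ *: _)]scaleNr BlD BrD BlZ BrZ.
  rewrite !scaleNr scalerDl opprD addrACA; congr (_ + _ + _).
have uA' : u *m (A - a%:M) *m (A - a%:M) ^+ k = 0 by rewrite -mulmxA.
have vA' : v *m (A - b%:M) *m (A - b%:M) ^+ l = 0 by rewrite -mulmxA.
rewrite mulmxDl (IH k l.+1 _ _ kl uA') ?exprS// add0r.
by apply: (IH k.+1 l _ _ _ _ vA'); rewrite ?exprS// addSn -addnS.
Qed.

(** On the generalised eigenspace of [a], [q(A)] is the scalar [c a]; [B] maps the spaces of [a] and
    [b] into that of [a + b], so the Leibniz rule becomes additivity of [c]. The order of contact is
    twice [n.+1] because that is the exponent known to kill [B u v]. *)
Lemma derivation_interpolation (A : 'M[C]_n.+1) (s : seq C) (q : {poly C}) c :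
    derivation B A -> uniq s ->
    (forall a, root (char_poly A) a = (a \in s)) ->
    {morph c : a b / a + b} ->
    (forall a, a \in s -> ('X - a%:P) ^+ (n.+1 + n.+1) %| q - (c a)%:P) ->
  derivation B (horner_mx A q).
Proof.
move=> dB us rs cD qP.
have gen0 a u : u *m (A - a%:M) ^+ (n.+1 + n.+1) = 0 ->
    u *m horner_mx A q = c a *: u.
  have hA k : (A - a%:M) ^+ k = horner_mx A (('X - a%:P) ^+ k).
    by rewrite rmorphXn rmorphB /= horner_mx_X horner_mx_C.
  have [ais|nas] := boolP (a \in s).
    have /dvdpP[d qE] := qP _ ais.
    move=> u0; rewrite -[q](subrK (c a)%:P) qE mulrC rmorphD rmorphM /=.
    rewrite horner_mx_C mulmxDr -hA [_ * _]/(_ *m _) mulmxA u0 mul0mx add0r.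
    by rewrite mul_mx_scalar.
  (* If [a] is not an eigenvalue, [u] is zero; this covers the sums [a + b] outside the spectrum. *)
  move=> u0; suff -> : u = 0 by rewrite mul0mx scaler0.
  have cop : coprimep (('X - a%:P) ^+ (n.+1 + n.+1)) (char_poly A).
    by rewrite coprimep_expl// coprimep_sym coprimep_XsubC rs.
  have [[x y] /= xy] := Bezout_eq1_coprimepP _ _ cop.
  rewrite -[u]mulmx1 -[1%:M]/(1 : 'M[C]_n.+1) -(rmorph1 (horner_mx A)) -xy.
  rewrite mulrC rmorphD !rmorphM /= Cayley_Hamilton mulr0 addr0 -hA.
  by rewrite [_ * _]/(_ *m _) mulmxA u0 mul0mx.
have genS a u : u *m (A - a%:M) ^+ n.+1 = 0 -> u *m horner_mx A q = c a *: u.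
  move=> u0; apply: gen0.
  by rewrite exprD [_ * _]/(_ *m _) mulmxA u0 mul0mx.
have spanA (Q : 'rV[C]_n.+1 -> Prop) : Q 0 ->
    (forall u v, Q u -> Q v -> Q (u + v)) ->
    (forall a u, u *m (A - a%:M) ^+ n.+1 = 0 -> Q u) -> forall u, Q u.
  move=> Q0 QD Qg u; apply: (prod_root_pow_ind us Q0 QD (A := A) (m := n.+1)).
    by move=> a v _; apply: Qg.
  suff /dvdpP[d ->] : char_poly A %| \prod_(a <- s) ('X - a%:P) ^+ n.+1.
    by rewrite rmorphM /= Cayley_Hamilton mulr0 mulmx0.
  have [rsA charE] := closed_field_poly_normal (char_poly A).
  rewrite charE (monicP (char_poly_monic A)) scale1r.
  have sz : (size rsA <= n.+1)%N.
    have := size_char_poly A; rewrite charE (monicP (char_poly_monic A)).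
    by rewrite scale1r size_prod_XsubC => -[->].
  have srs : {subset rsA <= s}.
    move=> a ars; rewrite -rs charE (monicP (char_poly_monic A)) scale1r.
    by rewrite root_prod_XsubC.
  rewrite prodrXl.
  (* Each of the at most [n.+1] roots, counted with multiplicity, uses up one copy of the product
     over [s]. *)
  elim: rsA n.+1 sz srs {charE} => [|a t IH] [|m]//= sz srs.
  - by rewrite big_nil dvd1p.
  - by rewrite big_nil dvd1p.
  rewrite big_cons exprS dvdp_mul ?IH//.
    by rewrite (big_rem a)/= ?srs ?mem_head// dvdp_mulIl.
  by move=> x xt; apply: srs; rewrite inE xt orbT.
move=> u v; move: u v; apply: (spanA _) => [v|u1 u2 h1 h2 v|a u uA].
- by rewrite mul0mx !Bl0 mul0mx addr0.
- rewrite mulmxDl !BlD mulmxDl h1 h2.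
  by rewrite addrACA.
apply: (spanA _) => [|v1 v2 h1 h2|b v vA].
- by rewrite mul0mx !Br0 mul0mx addr0.
- rewrite mulmxDl !BrD mulmxDl h1 h2.
  by rewrite addrACA.
rewrite (genS _ _ _ uA) (genS _ _ _ vA) BlZ BrZ.
rewrite -scalerDl -cD; apply: gen0.
exact: derivation_geigen.
Qed.
End Derivation.

(** [S] is a polynomial in [A] interpolating complex conjugation on the spectrum. Conjugation is
    additive, which preserves derivations, and [a] times its conjugate is a nonnegative real, so a
    zero trace leaves only the eigenvalue 0. *)
Lemma conjugate_part n (A : 'M[C]_n) : exists S : 'M[C]_n,
  (\tr (A *m S) = 0 ->
     exists k, forall u : 'rV_n, iter k (mulmxr A) u = 0) /\
  forall B : 'rV[C]_n -> 'rV[C]_n -> 'rV[C]_n,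
    (forall v, linear (B^~ v)) -> (forall u, linear (B u)) ->
    derivation B A -> derivation B S.
Proof.
case: n A => [|n] A.
  exists 0; split=> [_|B _ _ _ u v]; last by rewrite thinmx0 [RHS]thinmx0.
  by exists 0%N => u; rewrite thinmx0.
have [rs charE] := closed_field_poly_normal (char_poly A).
rewrite (monicP (char_poly_monic A)) scale1r in charE.
have rsP a : root (char_poly A) a = (a \in undup rs).
  by rewrite mem_undup charE root_prod_XsubC.
have [q qP] := hermite_interpolation (fun a : C => a^*) (n.+1 + n.+1)
  (undup_uniq rs).
exists (horner_mx A q); split=> [tr0|B Bl Br dB]; last first.
  exact: (derivation_interpolation Bl Br dB (undup_uniq rs) rsP (@rmorphD _ _ _) qP).
have An : A ^+ n.+1 = 0.
  apply: trace_mul_conj_nilpotent tr0 => a; rewrite rsP => /qP /dvdpP[d].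
  move=> /(congr1 (horner^~ a)).
  rewrite hornerM horner_exp hornerXsubC subrr expr0n mulr0 hornerD hornerN.
  by rewrite hornerC => /eqP; rewrite subr_eq0 => /eqP.
exists n.+1 => u.
have -> k : iter k (mulmxr A) u = u *m A ^+ k.
  by elim: k => [|k /= ->]; rewrite ?expr0 ?mulmx1// exprSr [_ * _]/(_ *m _) mulmxA.
by rewrite An mulmx0.
Qed.
End ConjugatePart.

(** * Engel's theorem *)

Section LieBracket.
Context {R : realType} {n : nat}.
Local Notation C := (Cplx R).
Local Notation M := 'M[C]_n.
Implicit Types (x y z : M) (g : {vspace M}).

Lemma lie_is_linear x : linear (lie x).
Proof.
move=> a u v; rewrite /lie mulmxDr mulmxDl -scalemxAr -scalemxAl opprD.
by rewrite addrACA -scalerBr.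
Qed.
HB.instance Definition _ x :=
  GRing.isLinear.Build _ _ _ _ (lie x) (lie_is_linear x).

Lemma lieDr x y z : lie x (y + z) = lie x y + lie x z.
Proof. exact: linearD. Qed.

Lemma lieZr x a y : lie x (a *: y) = a *: lie x y.
Proof. exact: linearZ. Qed.

Lemma lie0r x : lie x 0 = 0.
Proof. exact: linear0. Qed.

Lemma lieNr x y : lie x (- y) = - lie x y.
Proof. exact: linearN. Qed.

Lemma lie_sumr (I : Type) (r : seq I) (P : pred I) (F : I -> M) x :
  lie x (\sum_(i <- r | P i) F i) = \sum_(i <- r | P i) lie x (F i).
Proof. exact: linear_sum. Qed.

Lemma lieE x y : lie x y = x *m y - y *m x.
Proof. by []. Qed.

Lemma lieC x y : lie x y = - lie y x.
Proof. by rewrite /lie opprB. Qed.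

Lemma liexx x : lie x x = 0. Proof. exact: subrr. Qed.

Lemma lieDl x y z : lie (x + y) z = lie x z + lie y z.
Proof. by rewrite lieC lieDr opprD -!(lieC _ z). Qed.

Lemma lieZl a x y : lie (a *: x) y = a *: lie x y.
Proof. by rewrite lieC lieZr -scalerN -lieC. Qed.

Lemma lieNl x y : lie (- x) y = - lie x y.
Proof. by rewrite -scaleN1r lieZl scaleN1r. Qed.

Lemma lie0l x : lie 0 x = 0.
Proof. by rewrite lieC lie0r oppr0. Qed.

Lemma lie_suml (I : Type) (r : seq I) (P : pred I) (F : I -> M) x :
  lie (\sum_(i <- r | P i) F i) x = \sum_(i <- r | P i) lie (F i) x.
Proof. by rewrite lieC lie_sumr -sumrN; apply: eq_bigr => i _; rewrite -lieC. Qed.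

Lemma jacobi x y z : lie x (lie y z) = lie (lie x y) z + lie y (lie x z).
Proof.
rewrite /lie !(mulmxBl, mulmxBr) !mulmxA.
move: (x *m y *m z) (x *m z *m y) (y *m x *m z) (y *m z *m x)
  (z *m x *m y) (z *m y *m x) => a b c d e f.
by apply/matrixP => i j; rewrite !mxE; ring.
Qed.

Lemma adE x y : ad x y = lie x y.
Proof. by rewrite /ad add_lfunE opp_lfunE !lfunE. Qed.

Lemma memv_centralizer g x y : (y \in centralizer g x) = (y \in g) && (lie x y == 0).
Proof. by rewrite memv_cap memv_ker adE. Qed.

Definition subalgebra g := forall x y, x \in g -> y \in g -> lie x y \in g.

Definition ad_nilpotent g x :=
  exists k, forall y, y \in g -> iter k (lie x) y = 0.

Lemma memv_iter_lie g k x y : subalgebra g -> x \in g -> y \in g ->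
  iter k (lie x) y \in g.
Proof. by move=> gs xg yg; elim: k => //= k; apply: gs. Qed.

End LieBracket.

Opaque lie.

Section MaximalSubspace.
Variables (K : fieldType) (vT : vectType K).
Implicit Types U W : {vspace vT}.

Lemma dimv_lt U W : (U <= W)%VS -> W <> U -> (\dim U < \dim W)%N.
Proof.
move=> UW WU; rewrite ltn_neqAle dimvS// andbT.
by apply: contra_notN WU => dUW; apply/esym/eqP; rewrite eqEdim UW (eqP dUW) leqnn.
Qed.

Lemma maximal_vspace (P : {vspace vT} -> Prop) U0 : P U0 ->
  exists U, [/\ P U, (U0 <= U)%VS & forall W, P W -> (U <= W)%VS -> W = U].
Proof.
move: {2}(\dim {:vT} - \dim U0)%N (leqnn (\dim {:vT} - \dim U0)%N) => d.
elim: d U0 => [|d IH] U0 dU PU0;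
  have [[W [PW UW WU]]|noW] := pselect (exists W, [/\ P W, (U0 <= W)%VS & W <> U0]).
- have := dimv_lt UW WU; move: dU; rewrite leqn0 subn_eq0 => dU.
  by rewrite ltnNge (leq_trans (dimvS (subvf W)) dU).
- exists U0; split=> // W PW UW; apply: contrapT => WU; apply: noW; by exists W.
- have lt := dimv_lt UW WU.
  have [|U [PU WU' max]] := IH W _ PW; last by exists U; rewrite (subv_trans UW).
  rewrite -ltnS (leq_trans _ dU)// ltn_sub2l// (leq_trans lt)// dimvS ?subvf//.
- exists U0; split=> // W PW UW; apply: contrapT => WU; apply: noW; by exists W.
Qed.

Lemma line_memP U v u :
  u \in (U + <[v]>)%VS -> exists2 w, w \in U & exists a, u = w + a *: v.
Proof. by case/memv_addP=> w wU [_ /vlineP[a ->] ->]; exists w => //; exists a. Qed.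

End MaximalSubspace.

Section Engel.
Context {R : realType} {n : nat}.
Local Notation C := (Cplx R).
Local Notation M := 'M[C]_n.
Implicit Types (x y z : M) (g K U V : {vspace M}).

Lemma last_iterate_notin (T : Type) (P : set T) (f : T -> T) (u : T) k :
  ~ P u -> P (iter k f u) -> exists j, ~ P (iter j f u) /\ P (f (iter j f u)).
Proof.
move=> nPu; elim: k => [//|k IH] Pk.
by have [/IH//|nPk] := pselect (P (iter k f u)); exists k.
Qed.

(* Pairs U < V replace quotients: the induction uses the pair L < K of a maximal
   proper subalgebra L of K. *)
Lemma engel g d K U V :
    (\dim K <= d)%N -> subalgebra K -> (K <= g)%VS -> (V <= g)%VS ->
    (forall x, x \in K -> ad_nilpotent g x) ->
    (forall x y, x \in K -> y \in U -> lie x y \in U) ->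
    (forall x y, x \in K -> y \in V -> lie x y \in V) ->
    (U <= V)%VS -> ~~ (V <= U)%VS ->
  exists v, [/\ v \in V, v \notin U & forall x, x \in K -> lie x v \in U].
Proof.
elim: d K U V => [|d IH] K U V dK Ks Kg Vg nilK KU KV UV VU.
  have K0 : K = 0%VS by apply/eqP; rewrite -dimv_eq0 -leqn0.
  have /subvPn[v vV vU] := VU.
  exists v; split=> // x; rewrite K0 memv0 => /eqP ->.
  by rewrite lie0l mem0v.
have [K0|K0] := eqVneq K 0%VS.
  by apply: IH; rewrite // K0 dimv0.
pose P (L : {vspace M}) := [/\ subalgebra L, (L <= K)%VS & L <> K].
have P0 : P 0%VS.
  split; [|exact: sub0v|by move=> e; rewrite -e eqxx in K0].
  by move=> x y; rewrite !memv0 => /eqP-> _; rewrite lie0l.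
have [L [[Ls LK LneK] _ Lmax]] := maximal_vspace P0.
have dL : (\dim L <= d)%N.
  by rewrite -ltnS (leq_trans _ dK)// dimv_lt// => e; apply: LneK.
have nilL x : x \in L -> ad_nilpotent g x by move=> /(subvP LK); apply: nilK.
have LnK : ~~ (K <= L)%VS.
  by apply: contra_notN LneK => KL; apply/eqP; rewrite eqEsubv LK KL.
have LLK x y : x \in L -> y \in K -> lie x y \in K.
  by move=> /(subvP LK) xK yK; apply: Ks.
(* The pair [L < K] yields an [x] outside [L] that normalises [L]; then [L + <x>] is a subalgebra,
   equal to [K] by maximality. *)
have [x [xK xL Lx]] := IH L L K dL Ls (subv_trans LK Kg) Kg nilL Ls LLK LK LnK.
have LxK : (L + <[x]>)%VS = K.
  apply: contrapT => LxK; suff e : (L + <[x]>)%VS = L.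
    by move: xL; rewrite -e memvE addvSr.
  apply: Lmax; last exact: addvSl.
  split=> [|//|//]; last by rewrite subv_add LK -memvE.
  have xLx y : y \in L -> lie x y \in L.
    by move=> yL; rewrite lieC memvN Lx.
  move=> _ _ /line_memP[u uL [a ->]] /line_memP[v vL [b ->]].
  apply: (subvP (addvSl _ _)); rewrite lieDl lieZl !lieDr !lieZr liexx.
  rewrite scaler0 addr0; apply: memvD; last by rewrite memvZ ?xLx.
  by apply: memvD; [exact: Ls|rewrite memvZ ?Lx].
have LU u y : u \in L -> y \in U -> lie u y \in U.
  by move=> /(subvP LK); apply: KU.
have LV u y : u \in L -> y \in V -> lie u y \in V.
  by move=> /(subvP LK); apply: KV.
have [w [wV wU Lw]] := IH L U V dL Ls (subv_trans LK Kg) Vg nilL LU LV UV VU.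
have [k nilx] := nilK x xK.
have inv j : iter j (lie x) w \in V /\
    forall u, u \in L -> lie u (iter j (lie x) w) \in U.
  elim: j => [//|j [jV jU]] /=; split=> [|u uL]; first exact: KV.
  by rewrite jacobi memvD ?jU ?Lx// KU ?jU.
(* [L] sends every iterate of [ad x] on [w] into [U]. An iterate outside [U] whose successor lies in
   [U] is therefore sent into [U] by [x] as well, hence by [K]. *)
have [||j [/negP jU xj]] := @last_iterate_notin _ [set v | v \in U] (lie x) w k.
- exact/negP.
- by rewrite /= nilx ?mem0v// (subvP Vg).
have [jV jL] := inv j.
exists (iter j (lie x) w); split=> [||y]; [exact: jV|exact: jU|].
rewrite -LxK => /line_memP[u uL [a ->]].
by rewrite lieDl lieZl; apply: memvD; [exact: jL|apply: memvZ; exact: xj].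
Qed.

Lemma memv_commutator (U V : {vspace M}) x y :
  x \in U -> y \in V -> lie x y \in commutator_space U V.
Proof.
move=> xU yV; rewrite (coord_vbasis xU) (coord_vbasis yV) lie_suml.
rewrite memv_suml// => i _; rewrite lieZl memvZ// lie_sumr.
rewrite memv_suml// => j _; rewrite lieZr memvZ//.
rewrite memv_span//; apply/allpairsP; exists ((vbasis U)`_i, (vbasis V)`_j).
by rewrite !mem_nth ?size_tuple.
Qed.

Lemma commutator_sub (U V W : {vspace M}) :
  (forall x y, x \in U -> y \in V -> lie x y \in W) ->
  (commutator_space U V <= W)%VS.
Proof.
move=> UVW; apply/span_subvP => _ /allpairsP[[u v] /= [uU vV ->]].
by apply: UVW; apply: vbasis_mem.
Qed.

(** For a maximal proper [L]-stable subspace [U] of [L], Engel's theorem gives [v] outside [U] with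
    [[L, v]] inside [U]. Maximality yields [U + <v> = L], so [[L, L]] lies in [U]. *)
Lemma engel_not_perfect g (L : {vspace M}) :
  (L <= g)%VS -> L != 0%VS -> subalgebra L ->
  (forall x, x \in L -> ad_nilpotent g x) ->
  commutator_space L L != L.
Proof.
move=> Lg L0 Ls nilL; apply/eqP => LL.
pose P (U : {vspace M}) :=
  [/\ (U <= L)%VS, U <> L & forall x y, x \in L -> y \in U -> lie x y \in U].
have P0 : P 0%VS.
  split; [exact: sub0v|by move=> e; rewrite -e eqxx in L0|].
  by move=> x y _; rewrite !memv0 => /eqP->; rewrite lie0r.
have [U [[UL UneL LU] _ Umax]] := maximal_vspace P0.
have LnU : ~~ (L <= U)%VS.
  by apply: contra_notN UneL => LU'; apply/eqP; rewrite eqEsubv UL LU'.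
have [v [vL vU Lv]] := engel (leqnn _) Ls Lg Lg nilL LU Ls UL LnU.
have UvL : (U + <[v]>)%VS = L.
  apply: contrapT => UvL; suff e : (U + <[v]>)%VS = U.
    by move: vU; rewrite -e memvE addvSr.
  apply: Umax; last exact: addvSl.
  split=> [|//|x _ xL /line_memP[u uU [a ->]]]; first by rewrite subv_add UL -memvE.
  apply: (subvP (addvSl _ _)).
  by rewrite lieDr lieZr; apply: memvD; [exact: LU|apply: memvZ; exact: Lv].
move/negP: LnU; apply; rewrite -{1}LL; apply: commutator_sub => x y xL.
rewrite -{1}UvL => /line_memP[u uU [a ->]].
by rewrite lieDr lieZr; apply: memvD; [exact: LU|apply: memvZ; exact: Lv].
Qed.

End Engel.

(** * Cartan's criterion *)

Section KillingForm.
Context {R : realType} {n : nat}.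
Local Notation C := (Cplx R).
Local Notation M := 'M[C]_n.
Implicit Types (x y z : M).
Variable g : {vspace M}.
Local Notation N := (\dim g).
Local Notation b := (vbasis g).

Definition coords x : 'rV[C]_N := \row_j coord b j x.

Definition uncoords (u : 'rV[C]_N) : M := \sum_j u 0 j *: b`_j.

Lemma coords_is_linear : linear coords.
Proof. by move=> a x y; apply/rowP => j; rewrite !mxE linearP. Qed.
HB.instance Definition _ := GRing.isLinear.Build _ _ _ _ coords coords_is_linear.

Lemma uncoords_is_linear : linear uncoords.
Proof.
move=> a u v; rewrite /uncoords scaler_sumr -big_split; apply: eq_bigr => j _.
by rewrite /= !mxE scalerDl scalerA.
Qed.
HB.instance Definition _ :=
  GRing.isLinear.Build _ _ _ _ uncoords uncoords_is_linear.

Lemma uncoords_mem u : uncoords u \in g.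
Proof.
by apply: memv_suml => j _; rewrite memvZ// vbasis_mem// mem_nth// size_tuple.
Qed.

Lemma basis_mem (j : 'I_N) : b`_j \in g.
Proof. by rewrite vbasis_mem// mem_nth// size_tuple. Qed.

Lemma uncoordsK : cancel uncoords coords.
Proof.
move=> u; apply/rowP => j; rewrite mxE /uncoords.
by rewrite (coord_sum_free _ _ (basis_free (vbasisP g))).
Qed.

Lemma coordsK x : x \in g -> uncoords (coords x) = x.
Proof.
by move=> /coord_vbasis {2}->; apply: eq_bigr => j _; rewrite mxE.
Qed.

Lemma coords_basis (j : 'I_N) : coords b`_j = delta_mx 0 j.
Proof.
by apply/rowP => i; rewrite !mxE (coord_free _ _ (basis_free (vbasisP g))) eq_sym.
Qed.

Definition admx x : 'M[C]_N := \matrix_i coords (lie x b`_i).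

Lemma admx_is_linear : linear admx.
Proof.
move=> a x y; apply/row_matrixP => i.
by rewrite linearP /= !rowK lieDl lieZl linearP.
Qed.
HB.instance Definition _ := GRing.isLinear.Build _ _ _ _ admx admx_is_linear.

Lemma coords_lie x y : y \in g -> coords (lie x y) = coords y *m admx x.
Proof.
move=> yg; rewrite -{1}(coordsK yg) lie_sumr linear_sum mulmx_sum_row.
by apply: eq_bigr => i _; rewrite rowK lieZr linearZ.
Qed.

Hypothesis gs : subalgebra g.

(** Matrices act on row vectors from the right, which reverses products and hence the order in the
    commutator. *)
Lemma admx_lie x y : x \in g -> y \in g ->
  admx (lie x y) = admx y *m admx x - admx x *m admx y.
Proof.
move=> xg yg; apply/row_matrixP => i; rewrite [row i (_ - _)]linearB /=.
rewrite !row_mul !rowK.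
rewrite -!coords_lie ?gs ?basis_mem// -linearB /=; congr coords.
by rewrite jacobi addrK.
Qed.

Lemma killingE x y : y \in g -> killing g x y = \tr (admx y *m admx x).
Proof.
move=> yg; apply: eq_bigr => i _.
have -> : (admx y *m admx x) i i = coords (lie x (lie y b`_i)) 0 i.
  have -> (A : 'M[C]_N) : A i i = row i A 0 i by rewrite mxE.
  by rewrite row_mul rowK -coords_lie// gs ?basis_mem.
by rewrite mxE.
Qed.

Lemma killing_linearl y : linear (killing g ^~ y : M -> C^o).
Proof.
move=> a u v; rewrite /killing scaler_sumr -big_split; apply: eq_bigr => i _ /=.
by rewrite lieDl lieZl linearP.
Qed.

Lemma killingNl x y : killing g (- x) y = - killing g x y.
Proof.
by rewrite /killing -sumrN; apply: eq_bigr => i _; rewrite lieNl linearN.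
Qed.

Lemma killing0r x : killing g x 0 = 0.
Proof. by rewrite /killing big1// => i _; rewrite lie0l lie0r linear0. Qed.

Lemma killingDr x y z : killing g x (y + z) = killing g x y + killing g x z.
Proof.
rewrite /killing -big_split; apply: eq_bigr => i _ /=.
by rewrite lieDl lieDr linearD.
Qed.

Lemma killingC x y : x \in g -> y \in g -> killing g x y = killing g y x.
Proof.
by move=> xg yg; rewrite (killingE _ yg) (killingE _ xg) mxtrace_mulC.
Qed.

Lemma killing_linearr x : linear (killing g x : M -> C^o).
Proof.
move=> a u v; rewrite /killing scaler_sumr -big_split; apply: eq_bigr => i _ /=.
by rewrite lieDl lieZl lieDr lieZr linearP.
Qed.

Lemma killing_lie x y z : x \in g -> y \in g -> z \in g ->
  killing g (lie x y) z = killing g x (lie y z).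
Proof.
move=> xg yg zg; rewrite (killingE _ zg) (killingE _ (gs yg zg)).
rewrite (admx_lie xg yg) (admx_lie yg zg).
move: (admx x) (admx y) (admx z) => A B Z; rewrite mulmxBr mulmxBl !mulmxA.
have trB (P Q : 'M[C]_N) : \tr (P - Q) = \tr P - \tr Q by exact: linearB.
rewrite !trB; congr (_ - _).
by rewrite mxtrace_mulC mulmxA.
Qed.

Definition killing_row x : 'rV[C]_N := \row_i killing g x b`_i.

Lemma killing_row_is_linear : linear killing_row.
Proof.
by move=> a u v; apply/rowP => i; rewrite !mxE; apply: killing_linearl.
Qed.
HB.instance Definition _ :=
  GRing.isLinear.Build _ _ _ _ killing_row killing_row_is_linear.

Definition killing_radical : {vspace M} := (g :&: lker (linfun killing_row))%VS.

Lemma killing_radicalP x :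
  reflect (x \in g /\ forall y, y \in g -> killing g x y = 0)
          (x \in killing_radical).
Proof.
rewrite memv_cap memv_ker lfunE /=.
apply: (iffP andP) => [[xg /eqP k0]|[xg k0]]; split=> //.
  move=> y /coord_vbasis ->.
  pose G : {linear M -> C^o} := HB.pack (killing g x : M -> C^o)
    (GRing.isLinear.Build _ _ _ _ (killing g x : M -> C^o) (killing_linearr x)).
  rewrite -[killing g x]/(G : M -> C) linear_sum big1// => i _.
  rewrite linearZ /=; move/rowP/(_ i): k0; rewrite !mxE => ->.
  by rewrite scaler0.
by apply/eqP/rowP => i; rewrite !mxE k0// basis_mem.
Qed.

(* Let [s] act as the conjugate of [a] on the generalized
   [a]-eigenspace of [ad x]; it is a derivation of g, so for [x] in [L, L] the
   trace of [ad x \o s], which is the sum of the |a|^2, is a combination of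
   values of the Killing form on L * g. *)
Lemma perfect_radical_nilpotent (L : {vspace M}) x :
  (L <= killing_radical)%VS -> commutator_space L L = L -> x \in L ->
  ad_nilpotent g x.
Proof.
move=> LK LL xL.
have Lrad y : y \in L -> y \in g /\ forall z, z \in g -> killing g y z = 0.
  by move=> /(subvP LK)/killing_radicalP.
have [xg _] := Lrad x xL.
have [S [nilS derS]] := conjugate_part (admx x).
pose B u v := coords (lie (uncoords u) (uncoords v)).
have dB : derivation B S.
  apply: derS => [v a u1 u2|u a v1 v2|u v].
  - by rewrite /B linearP lieDl lieZl linearP.
  - by rewrite /B linearP lieDr lieZr linearP.
  have xE w : w *m admx x = coords (lie x (uncoords w)).
    by rewrite coords_lie ?uncoords_mem// uncoordsK.
  have lie_mem w : lie x (uncoords w) \in g by apply: gs => //; apply: uncoords_mem.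
  rewrite /B -coords_lie; last by apply: gs; apply: uncoords_mem.
  transitivity (coords (lie (lie x (uncoords u)) (uncoords v)) +
      coords (lie (uncoords u) (lie x (uncoords v)))).
    by rewrite jacobi; apply: (linearD coords).
  by congr (coords (lie _ _) + coords (lie _ _)); rewrite xE coordsK.
(* [s] is the derivation of [g] with matrix [S]; the Leibniz rule says that [ad (s y)] is the
   commutator of [s] and [ad y]. *)
pose s y := uncoords (coords y *m S).
have admx_s y : y \in g -> admx (s y) = admx y *m S - S *m admx y.
  move=> yg; apply/row_matrixP => i; rewrite linearB /=; apply/eqP.
  rewrite eq_sym subr_eq eq_sym !row_mul rowK; apply/eqP.
  rewrite rowK; set r := row i S.
  have := dB (coords y) (coords b`_i).
  rewrite /B !coordsK ?basis_mem// -/(s y) => ->; congr (_ + _).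
  by rewrite coords_basis -rowE -/r coords_lie ?uncoords_mem// uncoordsK.
have trS y : y \in L -> \tr (admx y *m S) = 0.
  pose f y : C^o := \tr (admx y *m S).
  have fl : linear f.
    by move=> a u v; rewrite /f linearP mulmxDl -scalemxAl linearP.
  pose F : {linear M -> C^o} := HB.pack f (GRing.isLinear.Build _ _ _ _ f fl).
  rewrite -LL => yLL.
  suff : y \in lker (linfun F) by rewrite memv_ker lfunE /= => /eqP.
  move: y yLL; apply/subvP/commutator_sub => u v uL vL.
  have [[ug u0] [vg _]] := (Lrad u uL, Lrad v vL).
  have trE (A B' : 'M[C]_N) :
      \tr ((B' *m A - A *m B') *m S) = - \tr (A *m (B' *m S - S *m B')).
    have trB (P Q : 'M[C]_N) : \tr (P - Q) = \tr P - \tr Q by exact: linearB.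
    rewrite mulmxBl mulmxBr !trB opprB !mulmxA; congr (_ - _).
    by rewrite -[in LHS]mulmxA [in LHS]mxtrace_mulC.
  rewrite memv_ker lfunE /= /f (admx_lie ug vg) trE -(admx_s _ vg) -killingE//.
  by rewrite killingC ?uncoords_mem// u0 ?uncoords_mem// oppr0.
have [k Sk] := nilS (trS x xL); exists k => y yg.
rewrite -[LHS]coordsK ?memv_iter_lie// -[RHS](linear0 uncoords).
congr uncoords; rewrite -(Sk (coords y)).
elim: k {Sk} => //= k <-; rewrite coords_lie//; exact: memv_iter_lie.
Qed.

Lemma killing_radical_ideal : lie_ideal g killing_radical.
Proof.
split; first exact: capvSl.
apply: commutator_sub => x y xg /killing_radicalP[yg y0].
apply/killing_radicalP; split=> [|z zg]; first exact: gs.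
by rewrite lieC -lieNr killing_lie ?memvN// y0// gs ?memvN.
Qed.

(** The derived series loses dimension until it is stationary, and its stable term is perfect. *)
Lemma iter_commutator_stationary (K : {vspace M}) : subalgebra K ->
  exists k, let L := iter k (fun U => commutator_space U U) K in
    [/\ (L <= K)%VS, subalgebra L & commutator_space L L = L].
Proof.
move: {2}(\dim K) (leqnn (\dim K)) => d.
elim: d K => [|d IH] K dK Ks; have KK := commutator_sub Ks.
  exists 0%N; split=> //=; apply/eqP; rewrite eqEdim KK.
  by rewrite (eqP (_ : \dim K == 0%N))// -leqn0.
have [KeqK|KneK] := pselect (commutator_space K K = K); first by exists 0%N.
have [||k [LK Ls LL]] := IH (commutator_space K K).
- by rewrite -ltnS (leq_trans _ dK)// dimv_lt// => e; apply: KneK.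
- by move=> x y /(subvP KK) xK /(subvP KK) yK; apply: memv_commutator.
by exists k.+1; rewrite iterSr; split=> //; apply: subv_trans KK.
Qed.

Hypothesis hss : semisimple_lie_algebra g.

(** By semisimplicity it is enough that the radical of the form is solvable. The stable term of its
    derived series is perfect and, lying in the radical, ad-nilpotent; Engel's theorem leaves only
    zero. *)
Lemma killing_nondegenerate x : x \in g ->
  (forall y, y \in g -> killing g x y = 0) -> x = 0.
Proof.
move=> xg x0; have xK : x \in killing_radical by apply/killing_radicalP.
suff K0 : killing_radical = 0%VS by move: xK; rewrite K0 memv0 => /eqP.
have [Kg gK] := killing_radical_ideal.
apply: hss; first exact: killing_radical_ideal.
have [|k [LK Ls LL]] := @iter_commutator_stationary killing_radical.
  move=> u v uK vK; apply: (subvP gK); apply: memv_commutator => //.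
  exact: (subvP Kg).
exists k; apply: contrapT => /eqP L0.
have := engel_not_perfect (subv_trans LK Kg) L0 Ls
  (fun y => perfect_radical_nilpotent LK LL).
by rewrite LL eqxx.
Qed.

(** The Gram matrix of the basis is invertible: a row in its kernel gives an element of the radical
    of the form. *)
Lemma killing_gradient (l : {linear M -> C^o}) :
  exists2 u, u \in g & forall w, w \in g -> killing g u w = l w.
Proof.
pose k : 'M[C]_N := \matrix_i killing_row b`_i.
have kE r : r *m k = killing_row (uncoords r).
  rewrite /uncoords linear_sum mulmx_sum_row; apply: eq_bigr => i _.
  by rewrite rowK linearZ.
have ku : k \in unitmx.
  rewrite -row_free_unit -kermx_eq0; apply/eqP/row_matrixP => i.
  rewrite row0; set r := row i _.
  have rk : r *m k = 0 by rewrite /r -row_mul mulmx_ker row0.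
  rewrite -[r]uncoordsK (_ : uncoords r = 0) ?linear0//.
  have rK : uncoords r \in killing_radical.
    by rewrite memv_cap uncoords_mem memv_ker lfunE /= -kE rk.
  by have /killing_radicalP[rg r0] := rK; apply: killing_nondegenerate.
exists (uncoords ((\row_j l b`_j) *m invmx k)); first exact: uncoords_mem.
move=> w /coord_vbasis ->; set u := uncoords _.
pose G : {linear M -> C^o} := HB.pack (killing g u : M -> C^o)
    (GRing.isLinear.Build _ _ _ _ (killing g u : M -> C^o) (killing_linearr u)).
rewrite -[killing g u]/(G : M -> C) !linear_sum; apply: eq_bigr => j _.
rewrite !linearZ /=; congr (_ *: _).
have := kE ((\row_j l b`_j) *m invmx k); rewrite mulmxKV// => /rowP/(_ j).
by rewrite !mxE => ->.
Qed.

End KillingForm.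

(** * sl2-triples *)

Section Sl2Relations.
Variables (K : numFieldType) (V : lmodType K).

Lemma iterZ (B : {linear V -> V}) k a u : iter k B (a *: u) = a *: iter k B u.
Proof. by elim: k => //= k ->; rewrite linearZ. Qed.

Lemma iterB (B : {linear V -> V}) k u v :
  iter k B (u - v) = iter k B u - iter k B v.
Proof. by elim: k => //= k ->; rewrite linearB. Qed.

Lemma iter0 (B : {linear V -> V}) k : iter k B 0 = 0.
Proof. by elim: k => //= k ->; rewrite linear0. Qed.

(** This is [[A, B^(k+1)] = (k+1) B^k (T - k)] for [[A, B] = T] and [[T, B] = -2 B]. The abstract
    form serves twice, with [ad xi] and [ad eta] in either role. *)
Lemma commutator_iter (A B T : {linear V -> V}) :
    (forall v, A (B v) = B (A v) + T v) ->
    (forall v, T (B v) = B (T v) - 2%:R *: B v) ->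
  forall k w, A (iter k.+1 B w) =
    iter k.+1 B (A w) + k.+1%:R *: iter k B (T w - k%:R *: w).
Proof.
move=> AB TB.
have TBk k w : T (iter k B w) = iter k B (T w) - (2 * k)%:R *: iter k B w.
  elim: k w => [|k IH] w; first by rewrite scale0r subr0.
  rewrite /= TB IH linearB linearZ /= -addrA; congr (_ + _).
  by rewrite -opprD -scalerDl -natrD mulnS addnC.
elim=> [|k IH] w; first by rewrite /= AB scale1r scale0r subr0.
rewrite [iter k.+2 B w]iterS AB IH TBk linearD linearZ -addrA [in RHS]/=.
congr (_ + _).
rewrite !iterB !iterZ /= !linearB !linearZ /=.
set p := B (iter k B (T w)); set q := B (iter k B w).
rewrite !scalerA addrACA -scalerDl -[k.+2]addn1 [in RHS]natrD.
rewrite [in RHS]scalerDl scale1r; congr (_ + _); congr (_ *: _).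
by ring.
Qed.

(** The product [H (H + 1) ... (H + k - 1)] applied to [v]. *)
Fixpoint shifted_product (H : V -> V) k v :=
  if k is j.+1 then shifted_product H j (H v + j%:R *: v) else v.

(** Applying the factors one after another, the last nonzero vector is an eigenvector with
    eigenvalue [-j], and it has stayed in [U]. *)
Lemma eigenvector_of_shifted_product (H : V -> V) (U : set V) k v :
    (forall u a, U u -> U (H u + a *: u)) -> U v -> v != 0 ->
    shifted_product H k v = 0 ->
  exists u (j : nat), [/\ U u, u != 0 & H u = - j%:R *: u].
Proof.
move=> HU; elim: k v => [|k IH] v /= Uv v0; first by move=> e; rewrite e eqxx in v0.
have [e _|ne] := eqVneq (H v + k%:R *: v) 0; last by apply: IH => //; apply: HU.
by exists v, k; split=> //; apply/eqP; rewrite scaleNr -addr_eq0 e.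
Qed.

(** On the kernel of [A], [A^k B^k] is [(-1)^k k!] times the product of the [-T + i] for [i < k].
    When [B] is nilpotent, that product vanishes for large [k]. *)
Lemma shifted_product_iter (A B T : {linear V -> V}) :
    (forall v, A (B v) = B (A v) + T v) ->
    (forall v, T (B v) = B (T v) - 2%:R *: B v) ->
    (forall v, T (A v) = A (T v) + 2%:R *: A v) ->
  forall k v, A v = 0 -> exists2 c, c != 0 &
    iter k A (iter k B v) = c *: shifted_product (fun u => - T u) k v.
Proof.
move=> AB TB TA; elim=> [|k IH] v Av; first by exists 1; rewrite ?oner_eq0 ?scale1r.
have Av' : A (- T v + k%:R *: v) = 0.
  have := TA v; rewrite Av linear0 scaler0 addr0 => /esym ATv.
  by rewrite linearD linearN linearZ /= ATv Av scaler0 addr0 oppr0.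
have [c c0 E] := IH _ Av'; exists (- (k.+1%:R * c)).
  by rewrite oppr_eq0 mulf_neq0// pnatr_eq0.
rewrite [iter k.+1 A _]iterSr (commutator_iter AB TB) Av iter0 add0r.
have -> : T v - k%:R *: v = -1 *: (- T v + k%:R *: v).
  by rewrite scaleN1r opprD opprK.
by rewrite !iterZ E !scalerA mulrN1 mulNr.
Qed.

(** If [mu = -i] with [i] natural, no factor of the product vanishes; hence a nonzero lowest-weight
    vector [v = X w] of that weight is incompatible with nilpotency of [X]. *)
Lemma iter_lowering (X Y H : {linear V -> V}) :
    (forall v, X (Y v) = Y (X v) + H v) ->
    (forall v, H (Y v) = Y (H v) - 2%:R *: Y v) ->
    (forall v, H (X v) = X (H v) + 2%:R *: X v) ->
  forall v mu, Y v = 0 -> H v = mu *: v -> forall k w c, X w = c *: v ->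
    iter k.+1 X (iter k Y w) =
      (c * \prod_(1 <= j < k.+1) (j%:R * (mu - j.+1%:R))) *: v.
Proof.
move=> XY HY HX v mu Yv Hv; elim=> [|k IH] w c Xw.
  by rewrite /= big_geq// mulr1.
rewrite [iter k.+2 X _]iterSr (commutator_iter XY HY) Xw iterZ.
rewrite [iter k.+1 Y v]iterSr Yv iter0 scaler0 add0r iterZ.
rewrite (IH _ (c * (mu - k.+2%:R))).
  by rewrite scalerA [in RHS]big_nat_recr//=; congr (_ *: _); ring.
rewrite linearB linearZ /=.
have -> : X (H w) = H (X w) - 2%:R *: X w by rewrite HX addrK.
by rewrite Xw linearZ /= Hv !scalerA -!scalerBl; congr (_ *: _); ring.
Qed.

End Sl2Relations.

Section Transversality.
Context {R : realType} {n : nat}.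
Local Notation C := (Cplx R).
Local Notation M := 'M[C]_n.
Variables (g : {vspace M}) (xi h eta : M).
Hypotheses (gs : subalgebra g) (hsl2 : sl2_triple g xi h eta).
Hypothesis nil_xi : ad_nilpotent g xi.

(** A nonzero vector of [[xi, g]] killed by [ad eta] would produce, through nilpotency of [ad xi],
    another one of weight [-i] with [i] natural; [iter_lowering] then contradicts the same
    nilpotency. This takes the place of complete reducibility. *)
Lemma sl2_ker_im w : w \in g -> lie eta (lie xi w) = 0 -> lie xi w = 0.
Proof.
have [[xig hg etag] xieta hxi heta] := hsl2.
have [N nilN] := nil_xi.
have XY v : lie xi (lie eta v) = lie eta (lie xi v) + lie h v.
  by rewrite jacobi xieta addrC.
have YX v : lie eta (lie xi v) = lie xi (lie eta v) + lie (- h) v.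
  by rewrite XY lieNl addrK.
have HX v : lie h (lie xi v) = lie xi (lie h v) + 2%:R *: lie xi v.
  by rewrite jacobi hxi lieZl addrC.
have HY v : lie h (lie eta v) = lie eta (lie h v) - 2%:R *: lie eta v.
  by rewrite jacobi heta lieNl lieZl addrC.
have NX v : lie (- h) (lie xi v) = lie xi (lie (- h) v) - 2%:R *: lie xi v.
  by rewrite !lieNl HX lieNr opprD.
have NY v : lie (- h) (lie eta v) = lie eta (lie (- h) v) + 2%:R *: lie eta v.
  by rewrite !lieNl HY lieNr opprD opprK.
move=> wg Yw; apply/eqP; apply: contrapT => /negP Xw0.
pose U : set M := [set v | lie eta v = 0 /\ exists2 w, w \in g & v = lie xi w].
have HU u a : U u -> U (lie h u + a *: u).
  move=> [Yu [u' u'g uE]]; split.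
    rewrite lieDr lieZr Yu scaler0 addr0.
    have E := HY u; rewrite Yu (lie0r h) scaler0 subr0 in E.
    exact: esym E.
  exists (lie h u' + (2%:R + a) *: u').
    by apply: memvD; [exact: gs|exact: memvZ].
  by rewrite lieDr lieZr uE HX [in RHS]scalerDl addrA.
have Uv : U (lie xi w) by split=> //; exists w.
have [c c0] := shifted_product_iter YX NX NY N Yw.
rewrite nilN ?gs// iter0 => /esym/eqP; rewrite scaler_eq0 (negPf c0) /= => /eqP.
have -> : (fun u => - lie (- h) u) = lie h.
  by apply/funext => u; rewrite lieNl opprK.
move/(eigenvector_of_shifted_product HU Uv Xw0).
case=> v [i [[Yv [u ug vE]] v0 Hv]].
have Xu : lie xi u = 1 *: v by rewrite scale1r.
have := iter_lowering XY HY HX Yv Hv N Xu.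
rewrite iterS nilN ?memv_iter_lie// linear0 => /esym/eqP.
rewrite scaler_eq0 (negPf v0) orbF mul1r prodf_seq_eq0.
case/hasP => j; rewrite mem_index_iota => /andP[j0 _].
(* For [mu = -i] the second factor is [-(i + j + 1)]. *)
rewrite mulf_eq0 pnatr_eq0 gtn_eqF//= -opprD oppr_eq0 -natrD pnatr_eq0.
by rewrite addnS.
Qed.

End Transversality.

(** * Polynomial and regular functions *)

Section MpolyInduction.
Variables (K : comNzRingType) (m : nat) (P : mpoly.mpoly m K -> Prop).

Lemma mpoly_ring_ind :
    (forall c, P (mpoly.mpolyC m c)) ->
    (forall i, P (mpoly.mpolyX K (mpoly.mnm1 i))) ->
    (forall p q, P p -> P q -> P (p + q)) ->
    (forall p q, P p -> P q -> P (p * q)) ->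
  forall p, P p.
Proof.
move=> PC PX PD PM p; rewrite (mpoly.mpolyE p).
elim/big_ind: _ => [||mm _].
- by rewrite -(mpoly.mpolyC0 m K); apply: PC.
- exact: PD.
rewrite -mpoly.mul_mpolyC; apply: (PM) => //.
rewrite mpoly.mpolyXE_id; elim/big_ind: _ => [||i _].
- by rewrite -(mpoly.mpolyC1 m K); apply: PC.
- exact: PM.
elim: (mm i) => [|k IH]; first by rewrite expr0 -(mpoly.mpolyC1 m K); apply: PC.
by rewrite exprS; apply: PM.
Qed.
End MpolyInduction.

Section FunSubalgebra.
Variables (T : Type) (K : comNzRingType).
Implicit Types (A : (T -> K) -> Prop) (F G : T -> K).

(** One notion for polynomial, regular, univariate, differentiable and translation-finite functions:
    closure under determinants, adjugates and polynomial substitution is proved once for all of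
    them. *)
Definition fun_subalgebra A :=
  [/\ forall c, A (fun=> c),
      forall F G, A F -> A G -> A (fun x => F x + G x) &
      forall F G, A F -> A G -> A (fun x => F x * G x)].

Variable A : (T -> K) -> Prop.
Hypothesis hA : fun_subalgebra A.

Lemma fun_subalgebra_sum (I : Type) (r : seq I) (P : pred I) (F : I -> T -> K) :
  (forall i, P i -> A (F i)) -> A (fun x => \sum_(i <- r | P i) F i x).
Proof.
have [Ac0 AD _] := hA; move=> AF; elim: r => [|i r IH].
  by under eq_fun do rewrite big_nil; apply: Ac0.
under eq_fun do rewrite big_cons.
by case: (boolP (P i)) => // /AF Fi; apply: AD.
Qed.

Lemma fun_subalgebra_prod (I : Type) (r : seq I) (P : pred I) (F : I -> T -> K) :
  (forall i, P i -> A (F i)) -> A (fun x => \prod_(i <- r | P i) F i x).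
Proof.
have [Ac0 _ AM] := hA; move=> AF; elim: r => [|i r IH].
  by under eq_fun do rewrite big_nil; apply: Ac0.
under eq_fun do rewrite big_cons.
by case: (boolP (P i)) => // /AF Fi; apply: AM.
Qed.

Lemma fun_subalgebra_opp F : A F -> A (fun x => - F x).
Proof.
have [Ac0 _ AM] := hA; move=> AF.
by under eq_fun do rewrite -mulN1r; apply: AM.
Qed.

Lemma fun_subalgebra_exp F k : A F -> A (fun x => F x ^+ k).
Proof.
have [Ac0 _ AM] := hA; move=> AF; elim: k => [|k IH]; first exact: Ac0.
by under eq_fun do rewrite exprS; apply: AM.
Qed.

Lemma fun_subalgebra_mulmx m p q (F : T -> 'M[K]_(m, p)) (G : T -> 'M[K]_(p, q)) :
  (forall i j, A (fun x => F x i j)) -> (forall i j, A (fun x => G x i j)) ->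
  forall i j, A (fun x => (F x *m G x) i j).
Proof.
have [_ _ AM] := hA; move=> AF AG i j; under eq_fun do rewrite mxE.
by apply: fun_subalgebra_sum => k _; apply: AM.
Qed.

Lemma fun_subalgebra_det m (F : T -> 'M[K]_m) :
  (forall i j, A (fun x => F x i j)) -> A (fun x => \det (F x)).
Proof.
have [Ac0 _ AM] := hA; move=> AF; apply: fun_subalgebra_sum => s _.
by apply: AM => //; apply: fun_subalgebra_prod => i _; apply: AF.
Qed.

Lemma fun_subalgebra_adj m (F : T -> 'M[K]_m) :
  (forall i j, A (fun x => F x i j)) -> forall i j, A (fun x => (\adj (F x)) i j).
Proof.
have [Ac0 _ AM] := hA; move=> AF i j; under eq_fun do rewrite mxE.
apply: AM => //; apply: fun_subalgebra_det => k l.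
by under eq_fun do rewrite !mxE; apply: AF.
Qed.

Lemma fun_subalgebra_meval m (c : 'I_m -> T -> K) (p : mpoly.mpoly m K) :
  (forall i, A (c i)) -> A (fun x => mpoly.meval (c ^~ x) p).
Proof.
have [Ac0 AD AM] := hA; move=> Ac; elim/mpoly_ring_ind: p => [k|i|p q Ap Aq|p q Ap Aq].
- by under eq_fun do rewrite mpoly.mevalC; apply: Ac0.
- by under eq_fun do rewrite mpoly.mevalXU; apply: Ac.
- by under eq_fun do rewrite mpoly.mevalD; apply: AD.
- by under eq_fun do rewrite mpoly.mevalM; apply: AM.
Qed.

Lemma fun_subalgebra_linear m p (l : {linear 'M[K]_(m, p) -> K^o})
    (F : T -> 'M[K]_(m, p)) :
  (forall i j, A (fun x => F x i j)) -> A (fun x => l (F x)).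
Proof.
have [Ac0 _ AM] := hA; move=> AF.
have E x : l (F x) = \sum_i \sum_j F x i j * l (delta_mx i j).
  rewrite {1}(matrix_sum_delta (F x)) linear_sum; apply: eq_bigr => i _.
  by rewrite linear_sum; apply: eq_bigr => j _; rewrite linearZ.
under eq_fun do rewrite E; apply: fun_subalgebra_sum => i _.
by apply: fun_subalgebra_sum => j _; apply: AM.
Qed.

End FunSubalgebra.

Section PolynomialOnMatrices.
Context {R : realType} {n : nat}.
Local Notation C := (Cplx R).
Local Notation M := 'M[C]_n.

Definition polynomial_fun (F : M -> C) :=
  exists p : entry_poly, forall a, eval_entries p a = F a.

Lemma polynomial_fun_subalgebra : fun_subalgebra polynomial_fun.
Proof.
split=> [c|F G [p pF] [q qG]|F G [p pF] [q qG]].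
- by exists (mpoly.mpolyC _ c) => a; rewrite /eval_entries mpoly.mevalC.
- by exists (p + q) => a; rewrite /eval_entries mpoly.mevalD -pF -qG.
- by exists (p * q) => a; rewrite /eval_entries mpoly.mevalM -pF -qG.
Qed.

Lemma polynomial_fun_entry i j : polynomial_fun (fun a => a i j).
Proof.
exists (mpoly.mpolyX _ (mpoly.mnm1 (mxvec_index i j))) => a.
by rewrite /eval_entries mpoly.mevalXU mxvecE.
Qed.

(** Regular functions on GL_n, with the power of the determinant cleared. Singular matrices are
    excluded because [invmx] is not an inverse there. *)
Definition regular_fun (F : M -> C) :=
  exists k : nat, exists2 P, polynomial_fun P &
    forall a, a \in unitmx -> F a * \det a ^+ k = P a.

Lemma polynomial_fun_det : polynomial_fun determinant.
Proof.
apply: (fun_subalgebra_det polynomial_fun_subalgebra (F := id)).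
exact: polynomial_fun_entry.
Qed.

Lemma polynomial_fun_det_exp k : polynomial_fun (fun a => \det a ^+ k).
Proof.
apply: (fun_subalgebra_exp polynomial_fun_subalgebra).
exact: polynomial_fun_det.
Qed.

Lemma regular_polynomial F : polynomial_fun F -> regular_fun F.
Proof. by move=> PF; exists 0%N, F => // a _; rewrite expr0 mulr1. Qed.

Lemma regular_fun_subalgebra : fun_subalgebra regular_fun.
Proof.
have [PC PD PM] := polynomial_fun_subalgebra.
have Pdet := polynomial_fun_det_exp.
split=> [c|F G [k [p Pp pF]] [l [q Pq qG]]|F G [k [p Pp pF]] [l [q Pq qG]]].
- by apply: regular_polynomial; apply: PC.
- exists (k + l)%N, (fun a => p a * \det a ^+ l + q a * \det a ^+ k).
    by apply: PD; apply: PM.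
  by move=> a ua; rewrite -pF// -qG// exprD; ring.
- exists (k + l)%N, (fun a => p a * q a); first exact: PM.
  by move=> a ua; rewrite -pF// -qG// exprD; ring.
Qed.

Lemma regular_fun_inv i j : regular_fun (fun a => invmx a i j).
Proof.
exists 1%N, (fun a => (\adj a) i j).
  apply: (fun_subalgebra_adj polynomial_fun_subalgebra (F := id)).
  exact: polynomial_fun_entry.
move=> a ua; rewrite /invmx ua mxE expr1 mulrC mulrA mulrV ?mul1r//.
Qed.

Lemma regular_fun_conj (x : M) i j :
  regular_fun (fun a => (invmx a *m x *m a) i j).
Proof.
have [RC _ _] := regular_fun_subalgebra.
apply: (fun_subalgebra_mulmx regular_fun_subalgebra) => {i j} i j; last first.
  exact/regular_polynomial/polynomial_fun_entry.
apply: (fun_subalgebra_mulmx regular_fun_subalgebra) => // {i j} i j.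
exact: regular_fun_inv.
Qed.

Definition univariate (f : C -> C) := exists q : {poly C}, forall t, f t = q.[t].

Lemma univariate_subalgebra : fun_subalgebra univariate.
Proof.
split=> [c|f g [p fp] [q gq]|f g [p fp] [q gq]].
- by exists c%:P => t; rewrite hornerC.
- by exists (p + q) => t; rewrite hornerD fp gq.
- by exists (p * q) => t; rewrite hornerM fp gq.
Qed.

Lemma univariate_line m p (x z : 'M[C]_(m, p)) i j :
  univariate (fun t => (x + t *: z) i j).
Proof.
by exists ((x i j)%:P + 'X * (z i j)%:P) => t; rewrite !mxE !hornerE.
Qed.

Lemma polynomial_fun_line F x z : polynomial_fun F ->
  univariate (fun t => F (x + t *: z)).
Proof.
case=> p pF; under eq_fun do rewrite -pF.
apply: (fun_subalgebra_meval univariate_subalgebra) => k.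
case/mxvec_indexP: k => i j; under eq_fun do rewrite mxvecE.
exact: univariate_line.
Qed.

End PolynomialOnMatrices.

(** * Differentials *)

Section HasDiff.
Variables (K : numFieldType) (V : normedModType K).
Implicit Types (F G l : V -> K) (p v : V).

(** A relation, so that a differential may be given by any convenient formula and two formulas
    compared through [has_diff_unique]. *)
Definition has_diff F p l := differentiable F p /\ 'd F p = l :> (V -> K).

Lemma has_diff_eq F p l l' : has_diff F p l -> l =1 l' -> has_diff F p l'.
Proof. by move=> [dF <-] /funext <-. Qed.

Lemma has_diff_unique F p l l' : has_diff F p l -> has_diff F p l' -> l = l'.
Proof. by move=> [_ <-] [_ <-]. Qed.

Lemma has_diff_cst (c : K) p : has_diff (fun=> c) p (fun=> 0).
Proof. by split; [exact: differentiable_cst | rewrite diff_cst]. Qed.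

Lemma has_diffD F G p l m : has_diff F p l -> has_diff G p m ->
  has_diff (fun x => F x + G x) p (fun v => l v + m v).
Proof.
move=> [dF <-] [dG <-]; split; first exact: differentiableD.
by rewrite [LHS]diffD.
Qed.

Lemma has_diffM F G p l m : has_diff F p l -> has_diff G p m ->
  has_diff (fun x => F x * G x) p (fun v => F p * m v + G p * l v).
Proof.
move=> [dF <-] [dG <-]; split; first exact: differentiableM.
by rewrite [LHS]diffM.
Qed.

Lemma has_diffN F p l : has_diff F p l -> has_diff (fun x => - F x) p (fun v => - l v).
Proof.
move=> [dF <-]; split; first exact: differentiableN.
by rewrite [LHS]diffN.
Qed.

Lemma has_diff_sum (I : Type) (r : seq I) (P : pred I) (F l : I -> V -> K) p :
  (forall i, P i -> has_diff (F i) p (l i)) ->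
  has_diff (fun x => \sum_(i <- r | P i) F i x) p
    (fun v => \sum_(i <- r | P i) l i v).
Proof.
move=> Fl; elim: r => [|i r IH].
  under eq_fun do rewrite big_nil; apply: has_diff_eq (has_diff_cst 0 p) _ => v.
  by rewrite big_nil.
under eq_fun do rewrite big_cons.
case: (boolP (P i)) => [Pi|nPi].
  apply: has_diff_eq (has_diffD (Fl i Pi) IH) _ => v; by rewrite big_cons Pi.
by apply: has_diff_eq IH _ => v; rewrite big_cons (negPf nPi).
Qed.

Lemma has_diff_linear (l : {linear V -> K^o}) p : continuous l -> has_diff l p l.
Proof. by move=> cl; split; [exact: linear_differentiable | rewrite diff_lin]. Qed.

Lemma differentiable_subalgebra p : fun_subalgebra (fun F : V -> K => differentiable F p).
Proof.
split=> [c|F G dF dG|F G dF dG].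
- exact: differentiable_cst.
- exact: differentiableD.
- exact: differentiableM.
Qed.

Lemma near_differentiable F G p :
  (\forall x \near p, F x = G x) -> differentiable F p ->
  differentiable G p /\ 'd G p = 'd F p :> (V -> K).
Proof.
move=> FG dF; have GF : F p = G p by exact: nbhs_singleton FG.
have oG : G \o shift p = cst (G p) + 'd F p +o_ 0 id.
  apply/eqaddoP => e e0; have /eqaddoP/(_ e e0) := diff_locally dF.
  have : \forall x \near (0 : V), F (x + p) = G (x + p).
    by rewrite (near_shift p) sub0r; near=> x; rewrite /= subrK; near: x.
  by apply: filterS2 => x /= FGx; rewrite !fctE /= FGx GF.
have dFc := diff_continuous dF.
have E := diff_unique dFc oG.
by split; [apply/diff_locallyP; split; rewrite E|exact: E].
Unshelve. all: by end_near. Qed.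

Lemma has_diff_near F G p l : (\forall x \near p, F x = G x) ->
  has_diff F p l -> has_diff G p l.
Proof. by move=> /near_differentiable FG [/FG[dG E] <-]; split. Qed.

Lemma has_diff_meval m (c dc : 'I_m -> V -> K) p (q : mpoly.mpoly m K) :
  (forall i, has_diff (c i) p (dc i)) ->
  has_diff (fun x => mpoly.meval (c ^~ x) q) p
    (fun v => \sum_i dc i v * mpoly.meval (c ^~ p) (mpoly.mderiv i q)).
Proof.
move=> cdc; elim/mpoly_ring_ind: q => [k|i|q r hq hr|q r hq hr].
- under eq_fun do rewrite mpoly.mevalC.
  apply: has_diff_eq (has_diff_cst _ _) _ => v; rewrite big1// => i _.
  by rewrite mpoly.mderivC mpoly.meval0 mulr0.
- under eq_fun do rewrite mpoly.mevalXU.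
  apply: has_diff_eq (cdc i) _ => v; rewrite (bigD1 i)//= big1 => [|j ji].
    rewrite addr0 mpoly.mderivX mpoly.mevalZ mpoly.mnm1E eqxx mul1r.
    have -> : mpoly.mnm_sub (mpoly.mnm1 i) (mpoly.mnm1 i) = mpoly.mnm0.
      by apply/mpoly.mnmP => j; rewrite mpoly.mnmBE subnn mpoly.mnm0E.
    by rewrite mpoly.mpolyX0 mpoly.meval1 mulr1.
  by rewrite mpoly.mderivX mpoly.mevalZ mpoly.mnm1E eq_sym (negPf ji) mul0r mulr0.
- under eq_fun do rewrite mpoly.mevalD.
  apply: has_diff_eq (has_diffD hq hr) _ => v; rewrite -big_split.
  by apply: eq_bigr => i _; rewrite /= mpoly.mderivD mpoly.mevalD mulrDr.
- under eq_fun do rewrite mpoly.mevalM.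
  apply: has_diff_eq (has_diffM hq hr) _ => v; rewrite !mulr_sumr -big_split.
  apply: eq_bigr => i _; rewrite /= mpoly.mderivM mpoly.mevalD !mpoly.mevalM.
  by ring.
Qed.
End HasDiff.

Section MatrixDiff.
Variables (C : numFieldType) (n : nat).
Local Notation M := 'M[C]_n.

Lemma has_diff_entry m p (a : 'M[C]_(m, p)) i j :
  has_diff (fun b : 'M[C]_(m, p) => b i j) a (fun X => X i j).
Proof.
have l : linear (fun b : 'M[C]_(m, p) => b i j : C^o).
  by move=> k u v; rewrite !mxE.
pose f : {linear 'M[C]_(m, p) -> C^o} := HB.pack (fun b : 'M[C]_(m, p) => b i j : C^o)
  (GRing.isLinear.Build _ _ _ _ (fun b : 'M[C]_(m, p) => b i j : C^o) l).
exact: (has_diff_linear (l := f) a (@coord_continuous _ m p i j)).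
Qed.

Section Composition.
Variables (V : normedModType C).

Lemma has_diff_linear_comp m p (l : {linear 'M[C]_(m, p) -> C^o})
    (F dF : V -> 'M[C]_(m, p)) x :
  (forall i j, has_diff (fun q => F q i j) x (fun v => dF v i j)) ->
  has_diff (fun q => l (F q)) x (fun v => l (dF v)).
Proof.
have E (a : 'M[C]_(m, p)) : l a = \sum_i \sum_j l (delta_mx i j) * a i j.
  rewrite {1}(matrix_sum_delta a) linear_sum; apply: eq_bigr => i _.
  rewrite linear_sum; apply: eq_bigr => j _.
  by rewrite linearZ [RHS]mulrC.
move=> dF_; under eq_fun do rewrite E.
apply: has_diff_eq => [|v]; last by rewrite [RHS]E.
apply: has_diff_sum => i _; apply: has_diff_sum => j _.
apply: has_diff_eq (has_diffM (has_diff_cst _ _) (dF_ i j)) _ => v.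
by rewrite mulr0 addr0.
Qed.

Lemma has_diff_mulmx m p k (A dA : V -> 'M[C]_(m, p)) (B dB : V -> 'M[C]_(p, k))
    x i j :
  (forall i j, has_diff (fun q => A q i j) x (fun v => dA v i j)) ->
  (forall i j, has_diff (fun q => B q i j) x (fun v => dB v i j)) ->
  has_diff (fun q => (A q *m B q) i j) x
    (fun v => (A x *m dB v + dA v *m B x) i j).
Proof.
move=> hA hB; under eq_fun do rewrite mxE.
apply: has_diff_eq => [|v]; last first.
  rewrite mxE [X in X + _]mxE [X in _ + X]mxE -big_split; reflexivity.
apply: has_diff_sum => s _.
apply: has_diff_eq (has_diffM (hA i s) (hB s j)) _ => v /=.
by rewrite [X in _ + X]mulrC.
Qed.

Lemma has_diff_cst_mx m p (x : 'M[C]_(m, p)) (a : V) i j :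
  has_diff (fun _ : V => x i j) a (fun=> (0 : 'M[C]_(m, p)) i j).
Proof. by apply: has_diff_eq (has_diff_cst _ _) _ => v; rewrite mxE. Qed.

Lemma near_unitmx (A : V -> M) x :
  (forall i j, differentiable (fun q => A q i j) x) -> A x \in unitmx ->
  \forall q \near x, A q \in unitmx.
Proof.
move=> dA; rewrite unitmxE unitfE => A0.
have /differentiable_continuous cdet : differentiable (fun q => \det (A q)) x.
  exact: (fun_subalgebra_det (differentiable_subalgebra x)).
have N : \forall q \near x, \det (A q) != 0 := cvgr_neq0 _ cdet A0.
near=> q; rewrite unitmxE unitfE; near: q; exact: N.
Unshelve. all: by end_near. Qed.

(** Cramer's formula describes [invmx] at invertible matrices only, hence the passage to a
    neighbourhood of [x]. *)
Lemma differentiable_invmx (A : V -> M) x :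
  (forall i j, differentiable (fun q => A q i j) x) -> A x \in unitmx ->
  forall i j, differentiable (fun q => invmx (A q) i j) x.
Proof.
move=> dA Au i j.
have := Au; rewrite unitmxE unitfE => A0.
pose F q := (\det (A q))^-1 * (\adj (A q)) i j.
have FE : \forall q \near x, F q = invmx (A q) i j.
  have N := near_unitmx dA Au; near=> q.
  have qu : A q \in unitmx by near: q; exact: N.
  by rewrite /invmx qu mxE.
suff dF : differentiable F x by have [] := near_differentiable FE dF.
apply: differentiableM.
  apply: differentiableV => //.
  exact: (fun_subalgebra_det (differentiable_subalgebra x)).
exact: (fun_subalgebra_adj (differentiable_subalgebra x)).
Unshelve. all: by end_near. Qed.

(** Once [P] is known to be differentiable, its differential is read off from the identity
    [A P = X A], valid near [x]; the inverse is never differentiated explicitly. *)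
Lemma has_diff_conj (A X dA dX : V -> M) x :
    (forall i j, has_diff (fun q => A q i j) x (fun v => dA v i j)) ->
    (forall i j, has_diff (fun q => X q i j) x (fun v => dX v i j)) ->
    A x \in unitmx ->
  let P q := invmx (A q) *m X q *m A q in
  forall i j, has_diff (fun q => P q i j) x
    (fun v => (invmx (A x) *m (dX v *m A x + X x *m dA v - dA v *m P x)) i j).
Proof.
move=> hA hX Au P.
have dA_ i j := proj1 (hA i j); have dX_ i j := proj1 (hX i j).
have dP i j : differentiable (fun q => P q i j) x.
  apply: (fun_subalgebra_mulmx (differentiable_subalgebra x)) => // {}i {}j.
  apply: (fun_subalgebra_mulmx (differentiable_subalgebra x)) => // {}i {}j.
  exact: differentiable_invmx.
pose D v : M := \matrix_(i, j) 'd (fun q => P q i j) x v.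
have hP i j : has_diff (fun q => P q i j) x (fun v => D v i j).
  by split=> //; apply/funext => v; rewrite mxE.
have AP i j : has_diff (fun q => (A q *m P q) i j) x
    (fun v => (X x *m dA v + dX v *m A x) i j).
  apply: has_diff_near (has_diff_mulmx i j hX hA).
  have N := near_unitmx dA_ Au; near=> q.
  have qu : A q \in unitmx by near: q; exact: N.
  by rewrite /P !mulmxA mulmxV// mul1mx.
have DE v : A x *m D v + dA v *m P x = X x *m dA v + dX v *m A x.
  apply/matrixP => i j.
  exact: (congr1 (@^~ v) (has_diff_unique (has_diff_mulmx i j hA hP) (AP i j))).
move=> i j; apply: has_diff_eq (hP i j) _ => v; congr (fun_of_matrix _ i j).
by rewrite [dX v *m _ + _]addrC -DE addrK mulKmx.
Unshelve. all: by end_near. Qed.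

End Composition.
End MatrixDiff.

(** * Tangent vectors of an algebraic group *)

Section TangentVectors.
Context {R : realType} {n : nat}.
Local Notation C := (Cplx R).
Local Notation M := 'M[C]_n.

Lemma has_diff_eval_entries (p : entry_poly) (V : normedModType C)
    (F dF : V -> M) x :
  (forall i j, has_diff (fun q => F q i j) x (fun v => dF v i j)) ->
  has_diff (fun q => eval_entries p (F q)) x
    (fun v => \sum_k mxvec (dF v) 0 k * eval_entries (mpoly.mderiv k p) (F x)).
Proof.
move=> hF; apply: (has_diff_meval (c := fun k q => mxvec (F q) 0 k)
  (dc := fun k v => mxvec (dF v) 0 k)) => k.
case/mxvec_indexP: k => i j; under eq_fun do rewrite mxvecE.
by apply: has_diff_eq (hF i j) _ => v; rewrite mxvecE.
Qed.

Variables (G : set M) (g : {vspace M}).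
Hypotheses (hG : linear_algebraic_group G) (hg : lie_algebra_of G g).

Let G1 : G 1%:M. Proof. by have [_ ?] := hG. Qed.
Let GM a b : G a -> G b -> G (a *m b). Proof. by have [_ _ + _] := hG; exact. Qed.
Let GV a : G a -> G (invmx a). Proof. by have [_ _ _ +] := hG; exact. Qed.

Lemma group_unitmx a : G a -> a \in unitmx.
Proof. by have [[I ->] _ _ _] := hG; case. Qed.

(** The vectors [Y a] are tangent to [G] at [a]. With [P = H det^k] a polynomial, [b |-> P (b a)]
    vanishes on [G], so its derivative at 1 along [Y] is zero; the nonzero factor [det a ^+ k] is
    then cancelled. *)
Lemma regular_fun_tangent (H l : M -> C) a Y :
    regular_fun H -> (forall b, G b -> H b = 0) -> G a -> Y \in g ->
    has_diff H a l ->
  l (Y *m a) = 0.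
Proof.
move=> [k [P [p pP] HP]] H0 Ga Yg hH.
have au := group_unitmx Ga.
have P0 b : G b -> P b = 0.
  by move=> Gb; rewrite -HP ?group_unitmx// H0// mul0r.
have ent (b : M) i j := has_diff_entry b i j.
have dP : has_diff P a (fun X => \det a ^+ k * l X).
  have ddet : differentiable (fun b : M => \det b ^+ k) a.
    apply: (fun_subalgebra_exp (differentiable_subalgebra a)).
    apply: (fun_subalgebra_det (differentiable_subalgebra a)) => i j.
    exact: (proj1 (ent a i j)).
  apply: has_diff_near (has_diff_eq (has_diffM hH (conj ddet erefl)) _).
    have N := near_unitmx (fun i j => proj1 (ent a i j)) au.
    near=> b; have bu : b \in unitmx by near: b; exact: N.
    by rewrite -HP.
  by move=> X /=; rewrite H0// mul0r add0r.
have [q qE] : polynomial_fun (fun b => P (b *m a)).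
  under eq_fun do rewrite -pP.
  apply: (fun_subalgebra_meval polynomial_fun_subalgebra) => s.
  case/mxvec_indexP: s => i j; under eq_fun do rewrite mxvecE.
  apply: (fun_subalgebra_mulmx polynomial_fun_subalgebra) => i' j'.
    exact: polynomial_fun_entry.
  by have [+ _ _] := @polynomial_fun_subalgebra R n; apply.
have q0 b : G b -> eval_entries q b = 0.
  by move=> Gb; rewrite qE; apply: P0; apply: GM.
have /hg/(_ q q0) := Yg.
have hq := has_diff_eval_entries q (ent 1%:M).
have hq' : has_diff (eval_entries q) 1%:M (fun X => \det a ^+ k * l (X *m a)).
  have -> : eval_entries q = fun b => eval_entries p (b *m a).
    by apply/funext => b; rewrite qE pP.
  have Ea : eval_entries p = P by apply/funext => b; rewrite pP.
  have hpa := has_diff_eval_entries p (ent a).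
  rewrite Ea in hpa; have lE := has_diff_unique dP hpa.
  apply: has_diff_eq.
    apply: (has_diff_eval_entries p (F := fun b => b *m a) (dF := fun X => X *m a)).
    move=> i j; under eq_fun do rewrite mxE.
    apply: has_diff_sum => s _.
    apply: has_diff_eq (has_diffM (ent 1%:M i s) (has_diff_cst _ _)) _ => X.
    by rewrite mulr0 add0r mulrC.
  by move=> X /=; rewrite mul1mx -[RHS]/((fun X => \det a ^+ k * l X) _) lE.
move=> sum0; have := congr1 (@^~ Y) (has_diff_unique hq hq').
have -> : \sum_s mxvec Y 0 s * eval_entries (mpoly.mderiv s q) 1%:M = 0.
  by rewrite -[RHS]sum0; apply: eq_bigr => s _; rewrite mulrC.
move/esym/eqP; rewrite mulf_eq0 expf_eq0 => /orP[/andP[_ /eqP a0]|/eqP//].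
by move: au; rewrite unitmxE unitfE a0 eqxx.
Unshelve. all: by end_near. Qed.

Let ent (b : M) i j := has_diff_entry b i j.
Let cst (x b : M) i j := has_diff_cst_mx x b i j.

(** If [p] vanishes on [G], so does [b |-> p (a^-1 b a)], whose derivative at 1 along [X] is that of
    [p] along [a^-1 X a]. *)
Lemma conj_mem a X : G a -> X \in g -> invmx a *m X *m a \in g.
Proof.
move=> Ga Xg; have au := group_unitmx Ga; apply/hg => p p0.
pose H b := eval_entries p (invmx a *m b *m a).
have hH : has_diff H 1%:M (fun X => \sum_k mxvec (invmx a *m X *m a) 0 k *
    eval_entries (mpoly.mderiv k p) (invmx a *m 1%:M *m a)).
  apply: (has_diff_eval_entries p (F := fun b => invmx a *m b *m a)
    (dF := fun X => invmx a *m X *m a)) => i j.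
  have h1 i' j' : has_diff (fun b => (invmx a *m b) i' j') (1%:M : M)
      (fun X => (invmx a *m X) i' j').
    apply: has_diff_eq (has_diff_mulmx i' j' (cst (invmx a) _) (ent 1%:M)) _.
    by move=> X'; rewrite mul0mx addr0.
  apply: has_diff_eq (has_diff_mulmx i j h1 (cst a _)) _.
  by move=> X'; rewrite mulmx0 add0r.
have HP : polynomial_fun H.
  have [Pc _ _] := @polynomial_fun_subalgebra R n.
  apply: (fun_subalgebra_meval polynomial_fun_subalgebra) => s.
  case/mxvec_indexP: s => i j; under eq_fun do rewrite mxvecE.
  apply: (fun_subalgebra_mulmx polynomial_fun_subalgebra) => // {}i {}j.
  apply: (fun_subalgebra_mulmx polynomial_fun_subalgebra) => // {}i {}j.
  exact: polynomial_fun_entry.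
have H0 b : G b -> H b = 0.
  by move=> Gb; apply: p0; apply: GM => //; apply: GM => //; apply: GV.
have := regular_fun_tangent (regular_polynomial HP) H0 G1 Xg hH.
rewrite !mulmx1 mulVmx// => E; rewrite -[RHS]E.
by apply: eq_bigr => k _; rewrite mulrC.
Qed.

(** By [conj_mem] the part of [b^-1 X b] outside [g] vanishes for [b] in [G]. Its derivative at 1
    along [Y] is the part of [[X, Y]] outside [g]. *)
Lemma lie_algebra_subalgebra : subalgebra g.
Proof.
move=> Y X Yg Xg.
have pil i j : linear (fun v : M => (v - projv g v) i j : C^o).
  move=> c u v; rewrite linearP opprD addrACA -scalerBr.
  by rewrite !mxE.
pose pi i j : {linear M -> C^o} := HB.pack (fun v : M => (v - projv g v) i j : C^o)
  (GRing.isLinear.Build _ _ _ _ (fun v : M => (v - projv g v) i j : C^o) (pil i j)).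
suff -> : lie Y X = projv g (lie Y X) by exact: memv_proj.
apply/eqP; rewrite -subr_eq0; apply/eqP/matrixP => i j; rewrite [RHS]mxE.
rewrite lieC linearN /= -opprD mxE; apply/eqP; rewrite oppr_eq0; apply/eqP.
pose H b := pi i j (invmx b *m X *m b).
have hH : has_diff H 1%:M (fun Z => pi i j (lie X Z)).
  have uI : (1%:M : M) \in unitmx by exact: unitmx1.
  have := has_diff_linear_comp (pi i j) (has_diff_conj (ent 1%:M) (cst X 1%:M) uI).
  move/has_diff_eq; apply => Z.
  by rewrite !invmx1 !mul1mx !mulmx1 add0r.
have HR : regular_fun H.
  apply: (fun_subalgebra_linear regular_fun_subalgebra) => k l.
  exact: regular_fun_conj.
have H0 b : G b -> H b = 0.
  by move=> Gb; rewrite /H /= projv_id ?subrr ?mxE// conj_mem.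
have := regular_fun_tangent HR H0 G1 Yg hH.
by rewrite mulmx1 /= => <-; rewrite mxE mxE.
Qed.
End TangentVectors.

(** * Polynomials on the Lie algebra *)

Section PolynomialsOnSubspace.
Context {R : realType} {n : nat}.
Local Notation C := (Cplx R).
Local Notation M := 'M[C]_n.
Variable g : {vspace M}.
Local Notation N := (\dim g).
Local Notation gT := (subvs_of g).
Implicit Types (q : mpoly.mpoly N C) (u v w : M).

Definition gcoord (k : 'I_N) : M -> C^o :=
  coord (vbasis g) k \o (vsval \o vsproj g).
HB.instance Definition _ k := GRing.Linear.on (gcoord k).

(** Extended from [g] to all matrices through [vsproj g], so that differentials are taken on the
    ambient normed space. *)
Definition gpoly q u : C := polyfun q (vsproj g u).

Definition dgpoly q u w : C :=
  \sum_k gcoord k w * gpoly (mpoly.mderiv k q) u.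

Lemma gpolyE q u : gpoly q u = mpoly.meval (gcoord ^~ u) q.
Proof. by []. Qed.

Lemma dgpoly_is_linear q u : linear (dgpoly q u : M -> C^o).
Proof.
move=> a v w; rewrite /dgpoly scaler_sumr -big_split; apply: eq_bigr => k _.
by rewrite /= linearP /= mulrDl scalerAl.
Qed.
HB.instance Definition _ q u :=
  GRing.isLinear.Build _ _ _ _ (dgpoly q u : M -> C^o) (dgpoly_is_linear q u).

(** The directional derivative kept as a polynomial, so that it can be iterated in a Taylor
    expansion and used as an entry of a determinant. *)
Definition dirderiv q w : mpoly.mpoly N C :=
  \sum_k mpoly.mpolyC N (gcoord k w) * mpoly.mderiv k q.

Lemma gpoly_dirderiv q u w : gpoly (dirderiv q w) u = dgpoly q u w.
Proof.
rewrite gpolyE /dirderiv.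
rewrite (big_morph (mpoly.meval (gcoord ^~ u)) (mpoly.mevalD _) (mpoly.meval0 _)).
by apply: eq_bigr => k _; rewrite mpoly.mevalM mpoly.mevalC.
Qed.

Lemma has_diff_gpoly (V : normedModType C) (F dF : V -> M) x q :
  (forall i j, has_diff (fun p => F p i j) x (fun s => dF s i j)) ->
  has_diff (fun p => gpoly q (F p)) x (fun s => dgpoly q (F x) (dF s)).
Proof.
move=> hF.
apply: (has_diff_meval (c := fun k p => gcoord k (F p))
  (dc := fun k s => gcoord k (dF s))) => k.
exact: has_diff_linear_comp.
Qed.

Lemma has_diff_line u w (y : C) i j :
  has_diff (fun t : C => (u + t *: w) i j) y (fun t : C => (t *: w) i j).
Proof.
apply: (has_diff_eq (l := fun t => 0 + (0 + w i j * t))) => [|t]; last first.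
  by rewrite !add0r mxE mulrC.
under eq_fun do rewrite !mxE mulrC.
apply: has_diffD; first exact: has_diff_cst.
apply: has_diff_eq (has_diffM (has_diff_cst _ _) (has_diff_linear (l := idfun) y _)) _.
  exact: (fun x => @cvg_id _ _).
by move=> t /=; rewrite mulr0 addr0 add0r.
Qed.

Lemma derive1_gpoly q u w (y : C) :
  derive1 (fun t => gpoly q (u + t *: w)) y = dgpoly q (u + y *: w) w.
Proof.
have hF i j := has_diff_line u w y i j.
have [dF E] := has_diff_gpoly q hF.
by rewrite derive1E' // E scale1r.
Qed.

Lemma polyfun_line q u w : univariate (fun t => gpoly q (u + t *: w)).
Proof.
apply: (fun_subalgebra_meval univariate_subalgebra) => k.
apply: (fun_subalgebra_linear univariate_subalgebra (gcoord k)) => i j.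
exact: univariate_line.
Qed.

Section Invariance.
Variable G : set M.
Hypotheses (hG : linear_algebraic_group G) (hg : lie_algebra_of G g).

Lemma regular_fun_gpoly_conj q x :
  regular_fun (fun a => gpoly q (invmx a *m x *m a)).
Proof.
apply: (fun_subalgebra_meval regular_fun_subalgebra) => k.
apply: (fun_subalgebra_linear regular_fun_subalgebra (gcoord k)) => i j.
exact: regular_fun_conj.
Qed.

Lemma has_diff_gpoly_conj q x a : a \in unitmx ->
  has_diff (fun b => gpoly q (invmx b *m x *m b)) a
    (fun Z => dgpoly q (invmx a *m x *m a)
       (invmx a *m (x *m Z - Z *m (invmx a *m x *m a)))).
Proof.
move=> au.
have := has_diff_gpoly q (has_diff_conj (@has_diff_entry _ _ _ a)
  (has_diff_cst_mx x a) au).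
by move/has_diff_eq; apply => Z; rewrite mul0mx add0r.
Qed.

(** The function [b |-> q (b^-1 x b) - q x] vanishes on [G]; its derivative at 1 along [Y] is the
    differential of [q] along [[x, Y]]. *)
Lemma invariant_differential q x Y :
    invariant_polyfun G (polyfun q) -> x \in g -> Y \in g ->
  dgpoly q x (lie x Y) = 0.
Proof.
move=> [_ qinv] xg Yg.
have G1 : G 1%:M by have [_ ?] := hG.
have GV a : G a -> G (invmx a) by have [_ _ _ +] := hG; exact.
pose H b := gpoly q (invmx b *m x *m b) - gpoly q x.
have HR : regular_fun H.
  have [Rc RD _] := @regular_fun_subalgebra R n.
  by apply: RD; [exact: regular_fun_gpoly_conj | exact: Rc].
have H0 b : G b -> H b = 0.
  move=> Gb; apply/eqP; rewrite subr_eq0; apply/eqP.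
  have := qinv _ (vsproj g x) (GV b Gb).
  by rewrite vsprojK// /Ad invmxK.
have uI : (1%:M : M) \in unitmx by exact: unitmx1.
have hH := has_diffD (has_diff_gpoly_conj q x uI)
  (has_diff_cst (- gpoly q x) (1%:M : M)).
have := regular_fun_tangent hG hg HR H0 G1 Yg hH.
by rewrite !invmx1 !mul1mx !mulmx1 addr0.
Qed.
End Invariance.

Section LinearForms.
Variable l : 'Hom(gT, C^o).

(** Makes the coordinates [theta] polynomials too, so that every component of the system is some
    [gpoly] composed with [Phi]. *)
Definition linear_mpoly : mpoly.mpoly N C :=
  \sum_(k < N) mpoly.mpolyC N (l (vsproj g (vbasis g)`_k)) *
    mpoly.mpolyX C (mpoly.mnm1 k).

Lemma gpoly_linear_mpoly u : gpoly linear_mpoly u = l (vsproj g u).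
Proof.
rewrite gpolyE /linear_mpoly.
rewrite (big_morph (mpoly.meval (gcoord ^~ u)) (mpoly.mevalD _) (mpoly.meval0 _)).
have -> : vsproj g u = \sum_k gcoord k u *: vsproj g (vbasis g)`_k.
  apply: val_inj; rewrite /= {1}(coord_vbasis (subvsP (vsproj g u))) linear_sum.
  apply: eq_bigr => k _; rewrite [RHS]linearZ /=; congr (_ *: _).
  by rewrite vsprojK// vbasis_mem// mem_nth// size_tuple.
rewrite linear_sum; apply: eq_bigr => k _.
by rewrite mpoly.mevalM mpoly.mevalC mpoly.mevalXU linearZ mulrC.
Qed.

Lemma dgpoly_linear_mpoly u w : dgpoly linear_mpoly u w = l (vsproj g w).
Proof.
pose L : {linear M -> C^o} := l \o vsproj g.
have ent := @has_diff_entry _ _ _ u.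
have := has_diff_linear_comp L ent.
have -> : (fun v => L v) = (fun v => gpoly linear_mpoly v).
  by apply/funext => v; rewrite gpoly_linear_mpoly.
move=> h1; have := has_diff_unique h1 (has_diff_gpoly linear_mpoly ent).
by move=> /(congr1 (@^~ w)) <-; rewrite gpoly_linear_mpoly.
Qed.
End LinearForms.

End PolynomialsOnSubspace.

(** * The identity theorem on a connected group *)

Section MatrixContinuity.
Variables (K : numFieldType) (T : topologicalType) (m p : nat).

Lemma continuous_mx (F : T -> 'M[K]_(m, p)) x :
  (forall i j, {for x, continuous (fun y => F y i j)}) -> {for x, continuous F}.
Proof.
move=> cF; apply/cvg_ballP => e e0.
have N : \forall y \near x, forall ij : 'I_m * 'I_p,
    ball (F x ij.1 ij.2) e (F y ij.1 ij.2).
  apply: filter_forall => -[i j] /=.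
  exact: (cvg_ball (cF i j) e0).
by apply: filterS N => y H; split=> // i j; apply: (H (i, j)).
Qed.

End MatrixContinuity.
Section IdentityTheorem.
Context {R : realType} {n : nat}.
Local Notation C := (Cplx R).
Local Notation M := 'M[C]_n.
Implicit Types (a b u x : M) (F : M -> C).

(** Polynomials have this property, their translates staying in a finite-dimensional space.
    Finiteness lets one neighbourhood of 1 serve for all vanishing germs. *)
Definition translation_finite F :=
  exists (I : finType) (e : I -> M -> C) (rho : M -> I -> I -> C) (c : I -> C),
    (forall b a i, e i (b *m a) = \sum_j rho b i j * e j a) /\
    (forall a, F a = \sum_i c i * e i a).

Lemma translation_finite_subalgebra : fun_subalgebra translation_finite.
Proof.
split=> [k|F F' [I [e [rho [c [eE FE]]]]] [I' [e' [rho' [c' [eE' FE']]]]]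
          |F F' [I [e [rho [c [eE FE]]]]] [I' [e' [rho' [c' [eE' FE']]]]]].
- exists unit, (fun _ _ => 1), (fun _ _ _ => 1), (fun=> k); split=> [b a i|a].
    by rewrite big_const card_unit /= mulr1 addr0.
  by rewrite big_const card_unit /= mulr1 addr0.
- pose E (s : I + I') := match s with inl i => e i | inr i => e' i end.
  pose r b (s t : I + I') := match s, t with
    inl i, inl j => rho b i j | inr i, inr j => rho' b i j | _, _ => 0 end.
  pose d (s : I + I') := match s with inl i => c i | inr i => c' i end.
  exists (I + I')%type, E, r, d; split=> [b a s|a]; rewrite big_sumType /=.
    case: s => i /=; rewrite [X in X + _]/= [X in _ + X]/= ?eE ?eE'.
      by rewrite [X in _ + X]big1 ?addr0// => j _; rewrite mul0r.
    by rewrite [X in X + _]big1 ?add0r// => j _; rewrite mul0r.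
  by rewrite FE FE'.
- exists (I * I')%type, (fun s a => e s.1 a * e' s.2 a),
    (fun b s t => rho b s.1 t.1 * rho' b s.2 t.2), (fun s => c s.1 * c' s.2).
  split=> [b a s|a].
    rewrite eE eE' big_distrlr pair_bigA; apply: eq_bigr => t _ /=; ring.
  rewrite FE FE' big_distrlr pair_bigA; apply: eq_bigr => t _ /=; ring.
Qed.

Lemma translation_finite_entry i j : translation_finite (fun a => a i j).
Proof.
exists 'I_n, (fun k a => a k j), (fun b k l => b k l), (fun k => (k == i)%:R).
split=> [b a k|a]; first by rewrite mxE.
rewrite (bigD1 i)//= eqxx mul1r big1 ?addr0// => k /negPf ->.
by rewrite mul0r.
Qed.

Lemma translation_finite_polynomial F : polynomial_fun F -> translation_finite F.
Proof.
case=> p pF; have <- : eval_entries p = F by apply/funext => a; rewrite pF.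
apply: (fun_subalgebra_meval translation_finite_subalgebra) => k.
case/mxvec_indexP: k => i j; under eq_fun do rewrite mxvecE.
exact: translation_finite_entry.
Qed.

Lemma mulmx_continuous b : continuous (fun a => b *m a).
Proof.
move=> a; apply: continuous_mx => i j.
apply: differentiable_continuous.
apply: (fun_subalgebra_mulmx (differentiable_subalgebra a)) => k l.
  exact: differentiable_cst.
exact: (proj1 (has_diff_entry a k l)).
Qed.

Lemma invmx_mul_continuous b x : x \in unitmx ->
  {for x, continuous (fun a => invmx a *m b)}.
Proof.
move=> xu; apply: continuous_mx => i j; apply: differentiable_continuous.
apply: (fun_subalgebra_mulmx (differentiable_subalgebra x)) => k l.
  by apply: differentiable_invmx => // s t; apply: (proj1 (has_diff_entry x s t)).
exact: differentiable_cst.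
Qed.

Variables (G : set M).
Hypotheses (hG : linear_algebraic_group G) (cG : connected G).

Let G1 : G 1%:M. Proof. by have [_ ?] := hG. Qed.
Let GM a b : G a -> G b -> G (a *m b). Proof. by have [_ _ + _] := hG; exact. Qed.
Let GV a : G a -> G (invmx a). Proof. by have [_ _ _ +] := hG; exact. Qed.

Section Germs.
Variables (I : finType) (e : I -> M -> C) (rho : M -> I -> I -> C).
Hypothesis eE : forall b a i, e i (b *m a) = \sum_j rho b i j * e j a.

Let lc (c : {ffun I -> C^o}) a : C := \sum_i c i * e i a.
Let germ b c := \forall a \near b, G a -> lc c a = 0.
Let trans b (c : {ffun I -> C^o}) : {ffun I -> C^o} :=
  [ffun j => \sum_i c i * rho b i j].

Let lc_trans b c a : lc c (b *m a) = lc (trans b c) a.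
Proof.
rewrite /lc; under [RHS]eq_bigr do rewrite ffunE mulr_suml.
rewrite exchange_big; apply: eq_bigr => i _; rewrite eE mulr_sumr.
by apply: eq_bigr => j _; rewrite mulrA.
Qed.

Let lcP a k c d : lc (k *: c + d) a = k * lc c a + lc d a.
Proof.
rewrite /lc mulr_sumr -big_split; apply: eq_bigr => i _.
by rewrite !ffunE /= mulrDl mulrA.
Qed.

(* Finitely many germs span the germs vanishing at 1, hence a neighbourhood of 1
   on which they all vanish. *)
Let uniform_germ : exists2 W, open_nbhs (1%:M : M) W &
  forall c, germ 1%:M c -> forall a, W a -> G a -> lc c a = 0.
Proof.
pose P (U : {vspace {ffun I -> C^o}}) :=
  \forall a \near (1%:M : M), forall c, c \in U -> G a -> lc c a = 0.
have P0 : P 0%VS.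
  near=> a => c; rewrite memv0 => /eqP-> _.
  by rewrite /lc big1// => i _; rewrite ffunE mul0r.
have [U [PU _ Umax]] := maximal_vspace P0.
pose W := interior [set a : M | forall c, c \in U -> G a -> lc c a = 0].
have WU : W `<=` [set a | forall c, c \in U -> G a -> lc c a = 0].
  exact: interior_subset.
exists W; first by split; [exact: open_interior|exact: PU].
move=> c gc a Wa Ga.
suff cU : c \in U by apply: WU.
have <- : (U + <[c]>)%VS = U by apply: Umax; [|exact: addvSl];
  near=> x => _ /line_memP[d dU [k ->]] Gx; rewrite addrC lcP;
  rewrite (near PU x _ d dU Gx) ?addr0//; rewrite (near gc x)// mulr0.
by rewrite memvE addvSr.
Unshelve. all: by end_near. Qed.

(** Left translation by [b] turns a zero germ at [b] into one at 1, which vanishes on the uniform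
    neighbourhood [W]; transported back, the function vanishes on [b W], hence near [b u]. The size
    of [W] depends neither on [b] nor on [c]. *)
Let germ_translate : \forall u \near (1%:M : M), G u -> forall b c, G b ->
  germ b c -> germ (b *m u) c.
Proof.
have [W [Wo W1] WP] := uniform_germ.
have Wn : \forall u \near (1%:M : M), W u by apply: open_nbhs_nbhs.
near=> u => Gu b c Gb gc; have Wu : W u by near: u.
have bu := group_unitmx hG Gb.
have gtc : germ 1%:M (trans b c).
  have cb : (fun a => b *m a) @ (1%:M : M) --> b.
    by rewrite -[X in _ --> X](mulmx1 b); exact: mulmx_continuous.
  have N : \forall a \near (1%:M : M), G (b *m a) -> lc c (b *m a) = 0 := cb _ gc.
  by near=> a => Ga; rewrite -lc_trans; apply: (near N a) => //; apply: GM.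
have Wu' : \forall a \near u, W a by apply: open_nbhs_nbhs.
have cb : (fun a => invmx b *m a) @ (b *m u) --> u.
  by rewrite -[X in _ --> X](mulKmx bu u); exact: mulmx_continuous.
have N : \forall a \near (b *m u), W (invmx b *m a) := cb _ Wu'.
near=> a => Ga; rewrite -(mulKVmx bu a) lc_trans WP//; first exact: (near N a).
by apply: GM => //; apply: GV.
Unshelve. all: by end_near. Qed.

(** The points of [G] with zero germ form an open subset. It is also closed in [G]: if such an [x]
    is close to [b], then [x^-1 b] is close to 1 and [germ_translate] carries the zero germ from [x]
    to [b]. *)
Lemma germ_vanishing b0 c : G b0 -> germ b0 c -> forall b, G b -> lc c b = 0.
Proof.
move=> Gb0 g0.
have back b : G b -> \forall x \near b, G x -> germ x c -> germ b c.
  move=> Gb; have bu := group_unitmx hG Gb.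
  have cb : (fun x => invmx x *m b) @ b --> (1%:M : M).
    by rewrite -[X in _ --> X](mulVmx bu); exact: invmx_mul_continuous.
  have N : \forall x \near b, G (invmx x *m b) -> forall b' c, G b' ->
    germ b' c -> germ (b' *m (invmx x *m b)) c := cb _ germ_translate.
  near=> x => Gx gx; have xu := group_unitmx hG Gx.
  rewrite -(mulKVmx xu b); apply: (near N x) => //; apply: GM => //; exact: GV.
have E : [set b | G b /\ germ b c] = G.
  apply: cG; first by exists b0.
    exists [set b | germ b c] => //.
    rewrite openE => b; exact: near_join.
  (* The closed set is the complement of the points near which no element of [G] has zero germ. *)
  exists (~` [set b | \forall x \near b, G x -> ~ germ x c]).
    apply: open_closedC; rewrite openE => b; exact: near_join.
  apply/seteqP; split=> [b [Gb gb]|b [Gb gb]]; split.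
  - exact: Gb.
  - by move=> H; apply: (nbhs_singleton H).
  - exact: Gb.
  apply: contrapT => ngb; apply: gb.
  near=> x => Gx gx; apply: ngb; exact: (near (back b Gb) x).
move=> b Gb; have : [set b | G b /\ germ b c] b by rewrite E.
by case=> _ /nbhs_singleton; apply.
Unshelve. all: by end_near. Qed.
End Germs.

Lemma regular_identity F b0 : regular_fun F -> G b0 ->
  (\forall a \near b0, G a -> F a = 0) -> forall a, G a -> F a = 0.
Proof.
move=> [k [P hP FP]] Gb0 F0 a Ga.
have au := group_unitmx hG Ga.
have [I [e [rho [c [eE PE]]]]] := translation_finite_polynomial hP.
have : P a = 0.
  rewrite PE.
  have := @germ_vanishing I e rho eE b0 [ffun i => c i] Gb0.
  have cE x : \sum_i [ffun i => c i : C^o] i * e i x = P x.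
    by rewrite PE; apply: eq_bigr => i _; rewrite ffunE.
  move=> H; rewrite -PE -cE; apply: H => //.
  near=> x => Gx; rewrite cE -FP; last exact: (group_unitmx hG).
  by rewrite (near F0 x) ?mul0r.
rewrite -FP// => /eqP; rewrite mulf_eq0 expf_eq0 => /orP[/eqP//|/andP[_ /eqP d0]].
by move: au; rewrite unitmxE unitfE d0 eqxx.
Unshelve. all: by end_near. Qed.

End IdentityTheorem.

(** * Transversality of the slice *)

Section SliceTransversality.
Context {R : realType} {n : nat}.
Local Notation C := (Cplx R).
Local Notation M := 'M[C]_n.
Variables (g : {vspace M}) (r : nat) (xi h eta : M).
Hypotheses (gs : subalgebra g) (hsl2 : sl2_triple g xi h eta).
Hypothesis nil_xi : ad_nilpotent g xi.
Hypotheses (rxi : \dim (centralizer g xi) = r)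
  (reta : \dim (centralizer g eta) = r).

(** The two subspaces meet in zero by [sl2_ker_im], and regularity of both [xi] and [eta] makes
    their dimensions [\dim g - r] and [r]. *)
Lemma sl2_decomposition v : v \in g ->
  exists2 w, w \in g & exists2 c, c \in centralizer g eta & v = lie xi w + c.
Proof.
have [[xig _ _] _ _ _] := hsl2.
have imE u : reflect (exists2 w, w \in g & u = lie xi w) (u \in (ad xi @: g)%VS).
  apply: (iffP memv_imgP) => -[w wg ->]; exists w => //; rewrite adE//.
have img_sub : (ad xi @: g <= g)%VS.
  by apply/subvP => _ /imE[w wg ->]; apply: gs.
have dir : (ad xi @: g :&: centralizer g eta)%VS = 0%VS.
  apply/eqP; rewrite -subv0; apply/subvP => u.
  rewrite memv_cap => /andP[/imE[w wg ->]]; rewrite memv_centralizer.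
  move=> /andP[_ /eqP eta0]; rewrite memv0.
  by apply/eqP; apply: (sl2_ker_im gs hsl2 nil_xi).
have sumE : (ad xi @: g + centralizer g eta)%VS = g.
  apply/eqP; rewrite eqEdim subv_add img_sub capvSl /=.
  rewrite dimv_disjoint_sum// reta -rxi addnC.
  by rewrite /centralizer limg_ker_dim.
rewrite -{1}sumE => /memv_addP[_ /imE[w wg ->] [c cZ ->]].
by exists w => //; exists c.
Qed.

(* At xi + z the decomposition v = [xi, w v] + c v is perturbed by [z, w v], so
   the determinant of 1 + ad z \o w detects transversality. *)
Lemma slice_transversality : exists delta : M -> C,
  [/\ polynomial_fun delta, delta xi != 0 &
      forall x, x \in g -> delta x != 0 -> forall v, v \in g ->
        exists2 w, w \in g & exists2 c, c \in centralizer g eta &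
          v = lie x w + c].
Proof.
have [[xig _ _] _ _ _] := hsl2.
have ex (i : 'I_(\dim g)) : exists wc : M * M,
    [/\ wc.1 \in g, wc.2 \in centralizer g eta &
        (vbasis g)`_i = lie xi wc.1 + wc.2].
  by have [w wg [c cZ E]] := sl2_decomposition (basis_mem i); exists (w, c).
have [wc wcP] := choice ex.
pose B x : 'M[C]_(\dim g) := \matrix_i coords g (lie (x - xi) (wc i).1).
exists (fun x => \det (1%:M + B x)); split.
- have [Pc PD _] := @polynomial_fun_subalgebra R n.
  apply: (fun_subalgebra_det polynomial_fun_subalgebra) => i j.
  under eq_fun do rewrite mxE.
  apply: (PD); first exact: Pc.
  pose l : {linear M -> C^o} := coord (vbasis g) j \o lie (wc i).1.
  have E x : B x i j = - l (x - xi).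
    by rewrite !mxE lieC linearN.
  under eq_fun do rewrite E.
  apply: (fun_subalgebra_opp polynomial_fun_subalgebra).
  apply: (fun_subalgebra_linear polynomial_fun_subalgebra l) => k m.
  under eq_fun do rewrite mxE; apply: (PD); first exact: polynomial_fun_entry.
  exact: Pc.
- rewrite (_ : B xi = 0) ?addr0 ?det1 ?oner_eq0//.
  by apply/row_matrixP => i; rewrite rowK subrr lie0l linear0 row0.
move=> x xg dx v vg.
have Au : 1%:M + B x \in unitmx by rewrite unitmxE unitfE.
(* With these coefficients [v] is the sum of the [u_i (b_i + [x - xi, w_i])], and [b_i +
   [x - xi, w_i] = [x, w_i] + c_i]. *)
pose u := coords g v *m invmx (1%:M + B x).
exists (\sum_i u 0 i *: (wc i).1).
  by apply: memv_suml => i _; rewrite memvZ//; have [] := wcP i.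
exists (\sum_i u 0 i *: (wc i).2).
  by apply: memv_suml => i _; rewrite memvZ//; have [] := wcP i.
have uE : coords g v = u + u *m B x.
  by rewrite -{1}[u]mulmx1 -mulmxDr /u mulmxKV.
rewrite lie_sumr -big_split -[LHS](coordsK vg) uE linearD /=.
rewrite mulmx_sum_row linear_sum -big_split; apply: eq_bigr => i _ /=.
have [wg cZ bE] := wcP i.
rewrite rowK linearZ /= coordsK; last by rewrite gs// memvB.
rewrite bE lieZr -!scalerDr lieDl lieNl; congr (_ *: _).
by rewrite addrAC addrCA subrr addr0.
Qed.

End SliceTransversality.

(** * The phase space *)

Section PhaseSpaceGeometry.
Context {R : realType} {n : nat}.
Local Notation C := (Cplx R).
Local Notation M := 'M[C]_n.
Local Notation E := (M * M)%type.
Implicit Types (p q v w : E).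

Lemma PhiE p : Phi p = - (invmx p.1 *m p.2 *m p.1).
Proof. by rewrite /Phi /Ad invmxK. Qed.

Lemma conj_lie (a x y : M) : a \in unitmx ->
  invmx a *m lie x y *m a = lie (invmx a *m x *m a) (invmx a *m y *m a).
Proof.
move=> au.
have E s t : invmx a *m (s *m t) *m a = invmx a *m s *m a *m (invmx a *m t *m a).
  rewrite -[RHS]mulmxA -[invmx a *m t *m a]mulmxA (mulKVmx au).
  by rewrite -!mulmxA.
by rewrite !lieE mulmxBr mulmxBl !E.
Qed.

Definition dPhi p v : M :=
  - (invmx p.1 *m (v.2 *m p.1 + p.2 *m v.1 - v.1 *m (invmx p.1 *m p.2 *m p.1))).

Lemma dPhi_is_linear p : linear (dPhi p).
Proof.
move=> a u v; rewrite /dPhi /= scalerN -opprD scalemxAr -mulmxDr.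
congr (- (_ *m _)); rewrite !mulmxDl mulmxDr -!scalemxAl -scalemxAr.
rewrite (addrACA (a *: (u.2 *m p.1))) opprD -scalerDr.
by rewrite (addrACA (a *: (_ + _))) -scalerBr.
Qed.
HB.instance Definition _ p := GRing.isLinear.Build _ _ _ _ (dPhi p) (dPhi_is_linear p).

Lemma has_diff_fst p i j : has_diff (fun q : E => q.1 i j) p (fun v => v.1 i j).
Proof.
have l : linear (fun q : E => q.1 i j : C^o) by move=> a u v /=; rewrite !mxE.
pose f : {linear E -> C^o} := HB.pack (fun q : E => q.1 i j : C^o)
  (GRing.isLinear.Build _ _ _ _ (fun q : E => q.1 i j : C^o) l).
apply: (has_diff_linear (l := f)) => q.
apply: (@continuous_comp _ _ _ fst (fun a : M => a i j : C)); first exact: cvg_fst.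
exact: coord_continuous.
Qed.

Lemma has_diff_snd p i j : has_diff (fun q : E => q.2 i j) p (fun v => v.2 i j).
Proof.
have l : linear (fun q : E => q.2 i j : C^o) by move=> a u v /=; rewrite !mxE.
pose f : {linear E -> C^o} := HB.pack (fun q : E => q.2 i j : C^o)
  (GRing.isLinear.Build _ _ _ _ (fun q : E => q.2 i j : C^o) l).
apply: (has_diff_linear (l := f)) => q.
apply: (@continuous_comp _ _ _ snd (fun a : M => a i j : C)); first exact: cvg_snd.
exact: coord_continuous.
Qed.

Lemma has_diff_Phi p i j : p.1 \in unitmx ->
  has_diff (fun q => Phi q i j) p (fun v => dPhi p v i j).
Proof.
move=> pu; under eq_fun do rewrite PhiE mxE.
apply: has_diff_eq (has_diffN (has_diff_conj (has_diff_fst p) (has_diff_snd p) pu i j)) _.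
by move=> v; rewrite [RHS]mxE.
Qed.

Lemma has_diff_is_differential (X : set E) (F : E -> C) p (l : {linear E -> C^o}) :
  has_diff F p l -> is_differential X F p (linfun l).
Proof.
move=> [dF lE] e e0.
have /eqaddoP/(_ e e0) N := diff_locally dF.
have N' : \forall q \near p, `|F q - F p - l (q - p)| <= e * `|q - p|.
  rewrite (near_shift 0 p) /= subr0.
  apply: filterS N => x /=; rewrite !fctE /= addrK lE.
  by rewrite opprD addrA.
apply: filterS N' => q H _; rewrite lfunE; exact: H.
Qed.

Lemma dPhi_tangent p y z : p.1 \in unitmx ->
  dPhi p (y *m p.1, z) = - (invmx p.1 *m (z + lie p.2 y) *m p.1).
Proof.
move=> pu; rewrite /dPhi /=; congr (- _); rewrite -[RHS]mulmxA.
congr (_ *m _).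
rewrite mulmxDl -addrA; congr (_ + _).
by rewrite lieE mulmxBl !mulmxA (mulmxK pu).
Qed.

Variables (g : {vspace M}) (eta : M).

Definition group_direction p (y : M) : E := (y *m p.1, 0).
Definition slice_direction (z : M) : E := (0, z).

Lemma group_direction_is_linear p : linear (group_direction p).
Proof.
move=> a u v; rewrite [RHS]surjective_pairing /= /group_direction mulmxDl.
by rewrite -scalemxAl scaler0 addr0.
Qed.
HB.instance Definition _ p :=
  GRing.isLinear.Build _ _ _ _ (group_direction p) (group_direction_is_linear p).

Lemma slice_direction_is_linear : linear slice_direction.
Proof. by move=> a u v; rewrite [RHS]surjective_pairing /= scaler0 addr0. Qed.
HB.instance Definition _ :=
  GRing.isLinear.Build _ _ _ _ slice_direction slice_direction_is_linear.

Lemma phase_tangentE p : phase_tangent g eta p =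
  (linfun (group_direction p) @: g +
   linfun slice_direction @: centralizer g eta)%VS.
Proof. by []. Qed.

Lemma phase_tangentP p w : reflect
  (exists2 y, y \in g & exists2 z, z \in centralizer g eta & w = (y *m p.1, z))
  (w \in phase_tangent g eta p).
Proof.
rewrite phase_tangentE.
apply: (iffP memv_addP) => [[_ /memv_imgP[y yg ->] [_ /memv_imgP[z zZ ->] ->]]|].
  by exists y => //; exists z => //; rewrite !lfunE [LHS]surjective_pairing /= addr0 add0r.
move=> [y yg [z zZ ->]].
exists (linfun (group_direction p) y); first exact: memv_img.
exists (linfun slice_direction z); first exact: memv_img.
by rewrite !lfunE [RHS]surjective_pairing /= addr0 add0r.
Qed.

Lemma dim_phase_tangent p : p.1 \in unitmx ->
  \dim (phase_tangent g eta p) = (\dim g + \dim (centralizer g eta))%N.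
Proof.
move=> pu.
rewrite phase_tangentE.
rewrite dimv_disjoint_sum.
  congr (_ + _)%N; apply: limg_dim_eq; apply/eqP; rewrite -subv0; apply/subvP => u.
    rewrite memv_cap memv_ker lfunE /= => /andP[_ /eqP/(congr1 fst)/= u0].
    by rewrite memv0 -[u](mulmxK pu) u0 mul0mx.
  rewrite memv_cap memv_ker lfunE /= => /andP[_ /eqP/(congr1 snd)/= u0].
  by rewrite memv0 u0.
apply/eqP; rewrite -subv0; apply/subvP => u; rewrite memv_cap memv0.
case/andP=> /memv_imgP[y _ ->] /memv_imgP[z _]; rewrite !lfunE /= => /(congr1 fst) /= y0.
by rewrite /group_direction y0.
Qed.

(** * Hamiltonian vectors of the components *)

Section Differentials.
Variable (Q : mpoly.mpoly (\dim g) C).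

Definition dcomponent p v : C^o := dgpoly Q (Phi p) (dPhi p v).

Lemma dcomponent_is_linear p : linear (dcomponent p).
Proof. by move=> a u v; rewrite /dcomponent linearP [dgpoly _ _ _]linearP. Qed.
HB.instance Definition _ p :=
  GRing.isLinear.Build _ _ _ _ (dcomponent p) (dcomponent_is_linear p).

Lemma component_is_differential (X : set E) p : p.1 \in unitmx ->
  is_differential X (fun q => gpoly Q (Phi q)) p (linfun (dcomponent p)).
Proof.
move=> pu; apply: has_diff_is_differential.
apply: (@has_diff_gpoly _ _ _ E (@Phi R n)) => i j; exact: has_diff_Phi.
Qed.

Hypotheses (gs : subalgebra g) (hss : semisimple_lie_algebra g).

Lemma component_hamiltonian p : p.1 \in unitmx -> p.2 \in g ->
    (forall y, y \in g -> invmx p.1 *m y *m p.1 \in g) ->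
  exists u, [/\ u \in g,
    hamiltonian_vector (phase_tangent g eta p) (phase_form g p)
      (linfun (dcomponent p)) (u *m p.1, 0) &
    (forall y, y \in g -> dgpoly Q (Phi p) (lie (Phi p) y) = 0) ->
    lie p.2 u = 0].
Proof.
move=> pu xg conjg.
pose m (w : M) : M := - (invmx p.1 *m w *m p.1).
have ml : linear m.
  move=> a u v; rewrite /m mulmxDr mulmxDl -scalemxAr -scalemxAl opprD.
  by rewrite scalerN.
pose m' : {linear M -> M} := HB.pack m (GRing.isLinear.Build _ _ _ _ m ml).
pose l : {linear M -> C^o} := dgpoly Q (Phi p) \o m'.
have [u ug uE] := killing_gradient gs hss l.
exists u; split=> //.
  split; first by apply/phase_tangentP; exists u => //; exists 0; rewrite ?mem0v.
  move=> _ /phase_tangentP[y yg [z zZ ->]].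
  have zg : z \in g by move: zZ; rewrite memv_centralizer => /andP[].
  transitivity (l (z + lie p.2 y)); last first.
    by rewrite lfunE /= /dcomponent dPhi_tangent.
  rewrite -uE; last by rewrite memvD// gs.
  rewrite /phase_form /= !mulmxK// killing0r subr0.
  rewrite [RHS]killingDr; congr (_ + _).
  (* Invariance of the Killing form turns [- <x, [u, y]>] into [<u, [x, y]>]. *)
  by rewrite -!killing_lie// [lie u _]lieC killingNl.
(* The pairing of [[x, u]] with [y] is [- <u, [x, y]>], which up to sign is the differential of [Q]
   at [Phi p] along a bracket with [Phi p], hence zero. *)
move=> inv; apply: (killing_nondegenerate gs hss); first exact: gs.
move=> y yg; rewrite lieC killingNl killing_lie// uE ?gs//.
have -> : l (lie p.2 y) = dgpoly Q (Phi p) (lie (Phi p) (invmx p.1 *m y *m p.1)).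
  rewrite /= /m PhiE lieNl; congr (dgpoly _ _ (- _)).
  exact: conj_lie.
by rewrite inv ?oppr0// conjg.
Qed.
End Differentials.

End PhaseSpaceGeometry.

(** * Density *)

Section UnivariateIdentity.
Context {R : realType}.
Local Notation C := (Cplx R).

Lemma poly_vanishing_sequence (q : {poly C}) (s : nat -> C) :
  injective s -> (forall k, q.[s k] = 0) -> q = 0.
Proof.
move=> sI qs; apply/eqP; apply: contrapT => /negP q0.
have := @max_poly_roots _ q (map s (iota 0 (size q))) q0.
rewrite size_map size_iota ltnn => H; suff : false by []; apply: H.
  by apply/allP => _ /mapP[k _ ->]; rewrite /root qs.
by rewrite map_inj_uniq ?iota_uniq.
Qed.

Lemma univariate_mul_eq0 (f1 f2 : C -> C) t0 :
    univariate f1 -> univariate f2 -> (forall t, f1 t * f2 t = 0) ->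
  f1 t0 != 0 -> forall t, f2 t = 0.
Proof.
move=> [q1 E1] [q2 E2] f0 f1t0 t.
have : q1 * q2 = 0.
  apply: (@poly_vanishing_sequence _ (fun k => k%:R)) => [i j /eqP|k].
    by rewrite eqr_nat => /eqP.
  by rewrite hornerM -E1 -E2.
move/eqP; rewrite mulf_eq0 => /orP[] /eqP q0; last by rewrite E2 q0 horner0.
by rewrite E1 q0 horner0 eqxx in f1t0.
Qed.

Lemma univariate_near0 (f : C -> C) :
  univariate f -> (\forall t \near (0 : C), f t = 0) -> forall t, f t = 0.
Proof.
move=> [q E] /nbhs_ballP[e e0 He] t; rewrite E.
(* Denominators start at 2 so that every point lies strictly inside the ball of radius [e]. *)
rewrite (@poly_vanishing_sequence q (fun k => e / k.+2%:R)) ?horner0//.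
  move=> i j /(mulfI (lt0r_neq0 e0)) /invr_inj/eqP.
  by rewrite eqr_nat => /eqP[].
move=> k; rewrite -E; apply: He; rewrite -ball_normE /= sub0r normrN.
rewrite gtr0_norm; last by rewrite divr_gt0// ltr0n.
by rewrite ltr_pdivrMr ?ltr0n// ltr_pMr// ltr1n.
Qed.

Lemma has_diff_horner (q : {poly C}) (t : C) :
  has_diff (fun s : C => q.[s]) t (fun s => q^`().[t] * s).
Proof.
have hid : has_diff (fun s : C => s) t (fun s => s).
  exact: (has_diff_linear (l := idfun) t (fun x => @cvg_id _ _)).
elim/poly_ind: q => [|q c IH].
  under eq_fun do rewrite horner0.
  by apply: has_diff_eq (has_diff_cst _ _) _ => s; rewrite deriv0 horner0 mul0r.
under eq_fun do rewrite hornerMXaddC.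
apply: has_diff_eq (has_diffD (has_diffM IH hid) (has_diff_cst c t)) _ => s.
by rewrite derivMXaddC hornerD hornerMX addr0; ring.
Qed.

Lemma derivn_horner0_eq0 (q : {poly C}) :
  (forall k, q^`(k).[0] = 0) -> q = 0.
Proof.
move=> q0; apply/polyP => k; have := q0 k.
rewrite horner_coef0 coef_derivn addn0 coef0 => /eqP.
by rewrite mulrn_eq0 ffactnn eqn0Ngt fact_gt0 /= => /eqP.
Qed.

End UnivariateIdentity.

(** * Dominance of [Phi] and density of the independence locus *)

Section Dominance.
Context {R : realType} {n : nat}.
Local Notation C := (Cplx R).
Local Notation M := 'M[C]_n.
Local Notation E := (M * M)%type.
Variables (G : set M) (g : {vspace M}) (xi eta : M) (delta : M -> C).
Hypotheses (hG : linear_algebraic_group G) (hg : lie_algebra_of G g).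
Hypotheses (xig : xi \in g) (cG : connected G).
Hypotheses (pdelta : polynomial_fun delta) (delta_xi : delta xi != 0).
Hypothesis transv : forall x, x \in g -> delta x != 0 -> forall v, v \in g ->
  exists2 w, w \in g & exists2 c, c \in centralizer g eta & v = lie x w + c.
Local Notation S := (slodowy_slice g xi eta).
Local Notation N := (\dim g).
Implicit Types (Q : mpoly.mpoly N C).

Let G1 : G 1%:M. Proof. by have [_ ?] := hG. Qed.
Let GV a : G a -> G (invmx a). Proof. by have [_ _ _ +] := hG; exact. Qed.

Lemma slice_mem x : S x -> x \in g.
Proof.
rewrite /slodowy_slice /= memv_centralizer => /andP[xxi _].
by rewrite -(subrK xi x) memvD.
Qed.

Lemma slice_line x z t : S x -> z \in centralizer g eta -> S (x + t *: z).
Proof. by rewrite /slodowy_slice /= => Sx zZ; rewrite addrAC memvD// memvZ. Qed.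

Lemma slice_segment x y t : S x -> S y -> S (x + t *: (y - x)).
Proof.
move=> Sx Sy; apply: slice_line => //.
by rewrite -(subrKA xi) -[xi - x]opprB memvD ?memvN.
Qed.

Lemma slice_xi : S xi.
Proof. by rewrite /slodowy_slice /= subrr mem0v. Qed.

Lemma conjV_mem a X : G a -> X \in g -> a *m X *m invmx a \in g.
Proof.
by move=> Ga Xg; have := conj_mem hG hg (GV Ga) Xg; rewrite invmxK.
Qed.

Lemma dPhi_surjective a x w : G a -> S x -> delta x != 0 -> w \in g ->
  exists2 v, v \in phase_tangent g eta (a, x) & dPhi (a, x) v = w.
Proof.
move=> Ga Sx dx wg; have au := group_unitmx hG Ga.
have w'g : - (a *m w *m invmx a) \in g by rewrite memvN conjV_mem.
have [y yg [z zZ E]] := transv (slice_mem Sx) dx w'g.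
exists (y *m a, z); first by apply/phase_tangentP; exists y => //; exists z.
rewrite (@dPhi_tangent _ _ (a, x))//= addrC -E mulmxN mulNmx opprK.
by rewrite mulmxA mulKmx// mulmxKV.
Qed.

Lemma Phi_line (a x z : M) (t : C) : Phi (a, x + t *: z) =
  Phi (a, x) + t *: - (invmx a *m z *m a).
Proof.
by rewrite !PhiE /= mulmxDr mulmxDl opprD -scalemxAr -scalemxAl scalerN.
Qed.

Let vanishes Q := forall a x, G a -> S x -> gpoly Q (Phi (a, x)) = 0.

Lemma univariate_gpoly_Phi Q (a x z : M) :
  univariate (fun t => gpoly Q (Phi (a, x + t *: z))).
Proof. under eq_fun do rewrite Phi_line; exact: polyfun_line. Qed.

(** The slice is affine: on the line from [xi] to [x] both factors are polynomials in one variable,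
    and [delta] is nonzero at the starting point. *)
Lemma vanishing_on_slice Q a : G a ->
  (forall x, S x -> delta x * gpoly Q (Phi (a, x)) = 0) ->
  forall x, S x -> gpoly Q (Phi (a, x)) = 0.
Proof.
move=> Ga H x Sx.
have := @univariate_mul_eq0 _ (fun t => delta (xi + t *: (x - xi)))
  (fun t => gpoly Q (Phi (a, xi + t *: (x - xi)))) 0.
move=> /(_ (polynomial_fun_line _ _ pdelta) (univariate_gpoly_Phi _ _ _ _)).
rewrite scale0r addr0 => /(_ _ delta_xi 1); rewrite scale1r subrKC; apply=> t.
exact/H/slice_segment/Sx/slice_xi.
Qed.

(** Where [delta] is nonzero, [w] is the image under [dPhi] of some [(y a, z)]. The group part
    contributes zero by [regular_fun_tangent], the slice part because [Q] vanishes along a line;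
    [vanishing_on_slice] then removes the condition on [delta]. *)
Lemma vanishes_dirderiv Q w : vanishes Q -> w \in g -> vanishes (dirderiv Q w).
Proof.
move=> VQ wg a x Ga; move: x; apply: (vanishing_on_slice Ga) => x Sx.
have [->|dx] := eqVneq (delta x) 0; first by rewrite mul0r.
rewrite gpoly_dirderiv; apply/eqP; rewrite mulf_eq0; apply/orP; right.
have au := group_unitmx hG Ga.
have [_ /phase_tangentP[y yg [z zZ ->]] <-] := dPhi_surjective Ga Sx dx wg.
have dD : dPhi (a, x) (y *m a, z) = dPhi (a, x) (y *m a, 0) + dPhi (a, x) (0, z).
  rewrite -[RHS](linearD (dPhi (a, x))); congr (dPhi _ _).
  by rewrite [RHS]surjective_pairing /= addr0 add0r.
have E1 : dgpoly Q (Phi (a, x)) (dPhi (a, x) (y *m a, 0)) = 0.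
  have PhiN b : Phi (b, x) = invmx b *m (- x) *m b.
    by rewrite PhiE mulmxN mulNmx.
  have HR := regular_fun_gpoly_conj Q (- x).
  have H0 b : G b -> gpoly Q (invmx b *m (- x) *m b) = 0.
    by move=> Gb; rewrite -PhiN VQ.
  have := regular_fun_tangent hG hg HR H0 Ga yg (has_diff_gpoly_conj Q (- x) au).
  rewrite -PhiN => <-; congr (dgpoly _ _ _); rewrite /dPhi /= mul0mx add0r.
  by rewrite -mulmxN opprB PhiE /= mulmxN mulNmx opprK addrC.
have E2 : dgpoly Q (Phi (a, x)) (dPhi (a, x) (0, z)) = 0.
  have -> : dPhi (a, x) (0, z) = - (invmx a *m z *m a).
    by rewrite /dPhi /= mulmx0 mul0mx addr0 subr0 mulmxA.
  have := derive1_gpoly Q (Phi (a, x)) (- (invmx a *m z *m a)) 0.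
  rewrite scale0r addr0 => <-.
  have -> : (fun t => gpoly Q (Phi (a, x) + t *: - (invmx a *m z *m a))) = cst 0.
    by apply/funext => t; rewrite -Phi_line VQ//; apply: slice_line.
  exact: derive1_cst.
rewrite dD; apply/eqP; apply: etrans (linearD (dgpoly Q (Phi (a, x))) _ _) _.
by rewrite [X in X + _]E1 [X in _ + X]E2 addr0.
Qed.

Lemma Phi_dominant Q : vanishes Q -> forall u, u \in g -> gpoly Q u = 0.
Proof.
move=> VQ u ug.
(* The line from [Phi (1, xi) = - xi] in this direction reaches [u] at time 1; along it all Taylor
   coefficients of [Q] at time 0 vanish. *)
pose v := u + xi.
have vg : v \in g by rewrite memvD.
have Phi1 : Phi (1%:M, xi) = - xi by rewrite PhiE /= invmx1 mul1mx mulmx1.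
have taylor k : forall Q' (q : {poly C}), vanishes Q' ->
    (forall t, q.[t] = gpoly Q' (- xi + t *: v)) -> q^`(k).[0] = 0.
  elim: k => [|k IH] Q' q VQ' qE.
    by rewrite derivn0 qE scale0r addr0 -Phi1 VQ'//; apply: slice_xi.
  rewrite derivSn; apply: (IH (dirderiv Q' v)); first exact: vanishes_dirderiv.
  move=> t; rewrite gpoly_dirderiv -derive1_gpoly.
  have [dq qD] := has_diff_horner q t.
  have -> : (fun s => gpoly Q' (- xi + s *: v)) = (fun s => q.[s]).
    by apply/funext => s; rewrite qE.
  by rewrite derive1E' // qD mulr1.
have [q qE] := polyfun_line Q (- xi) v.
have q0 : q = 0.
  by apply: derivn_horner0_eq0 => k; apply: (taylor k Q) => // t; rewrite qE.
have := qE 1; rewrite q0 horner0 scale1r => <-.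
by rewrite /v addrCA addNr addr0.
Qed.

(** If the product vanished near [(a0, x0)], the identity theorem would extend this to all of [G]
    for each [x] near [x0], and then lines from [x0] would extend it to the whole slice for each
    [a], against dominance. *)
Lemma Phi_nonvanishing_dense Q : (exists2 u, u \in g & gpoly Q u != 0) ->
  G `*` S `<=` closure ((G `*` S) `&`
    [set p : E | p.1 \in unitmx /\ delta p.2 * gpoly Q (Phi p) != 0]).
Proof.
move=> [u ug Qu] [a0 x0] [/= Ga0 Sx0] B B0; apply: contrapT => noB.
suff VQ : vanishes Q by move: Qu; rewrite (Phi_dominant VQ ug) eqxx.
have [[A1 A2] /= [nA1 nA2] AB] : filter_prod (nbhs a0) (nbhs x0) B by exact: B0.
have local a x : A1 a -> A2 x -> G a -> S x ->
    delta x * gpoly Q (Phi (a, x)) = 0.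
  move=> A1a A2x Ga Sx; apply: contrapT => /eqP n0; apply: noB.
  exists (a, x); split; last exact: (AB (a, x)).
  by split=> //; split=> //; apply: (group_unitmx hG).
have onG x a : A2 x -> S x -> G a -> delta x * gpoly Q (Phi (a, x)) = 0.
  move=> A2x Sx; move: a.
  have [Rc _ RM] := @regular_fun_subalgebra R n.
  apply: (@regular_identity _ _ _ hG cG
    (fun a => delta x * gpoly Q (Phi (a, x))) a0) => //.
    apply: RM; first exact: Rc.
    have -> : (fun b => gpoly Q (Phi (b, x))) =
        fun b => gpoly Q (invmx b *m (- x) *m b).
      by apply/funext => b; rewrite PhiE mulmxN mulNmx.
    exact: regular_fun_gpoly_conj.
  apply: filterS nA1 => a A1a Ga; exact: local.
move=> a x Ga; move: x; apply: (vanishing_on_slice Ga) => x Sx.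
have [_ _ UM] := @univariate_subalgebra R.
have := @univariate_near0 R (fun t => delta (x0 + t *: (x - x0)) *
  gpoly Q (Phi (a, x0 + t *: (x - x0)))).
move=> /(_ (UM _ _ (polynomial_fun_line _ _ pdelta) (univariate_gpoly_Phi _ _ _ _))).
have seg_cvg : (fun t : C => x0 + t *: (x - x0)) @ (0 : C) --> x0.
  rewrite -[X in _ --> X]addr0 -(scale0r (x - x0)).
  apply: (@continuous_mx _ _ _ _ (fun t : C => x0 + t *: (x - x0)) 0) => i j.
  exact: differentiable_continuous (proj1 (has_diff_line _ _ _ _ _)).
have N : \forall t \near (0 : C), A2 (x0 + t *: (x - x0)) := seg_cvg _ nA2.
move=> /(_ _ 1); rewrite scale1r subrKC; apply.
near=> t; apply: onG => //; first exact: (near N t).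
exact: slice_segment.
Unshelve. all: by end_near. Qed.

Lemma Phi_nonvanishing_open Q :
  open [set p : E | p.1 \in unitmx /\ delta p.2 * gpoly Q (Phi p) != 0].
Proof.
rewrite openE => p [pu np].
have N1 : \forall q \near p, q.1 \in unitmx.
  by apply: near_unitmx => // i j; exact: (proj1 (has_diff_fst p i j)).
have [P PE] := pdelta.
have dE : delta = eval_entries P by apply/funext => x; rewrite PE.
have h1 := has_diff_eval_entries P (has_diff_snd p); rewrite -dE in h1.
have h2 := has_diff_gpoly Q (fun i j => has_diff_Phi i j pu).
have cont := differentiable_continuous (proj1 (has_diffM h1 h2)).
have N2 : \forall q \near p, delta q.2 * gpoly Q (Phi q) != 0 :=
  cvgr_neq0 _ cont np.
by near=> q; split; near: q; [exact: N1|exact: N2].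
Unshelve. all: by end_near. Qed.

End Dominance.

(** * Independence *)

Section DualBasis.
Context {R : realType} {n : nat}.
Local Notation C := (Cplx R).
Local Notation M := 'M[C]_n.
Variable g : {vspace M}.
Local Notation gT := (subvs_of g).
Local Notation N := (\dim g).
Variable theta : N.-tuple (covector g).
Hypothesis htheta : basis_of fullv theta.

Lemma sum_covector (c : 'I_N -> C) :
  (forall x : gT, \sum_i c i * tnth theta i x = 0) -> forall i, c i = 0.
Proof.
move=> c0; have /freeP := basis_free htheta; apply.
apply/lfunP => x; rewrite sum_lfunE [RHS]lfunE /= -[RHS](c0 x).
by apply: eq_bigr => i _; rewrite scale_lfunE (tnth_nth 0).
Qed.

(** The vector is chosen by [xget], so a dual basis has to be produced: its coordinates are the
    columns of the inverse of the matrix of [theta] in [vbasis g]. *)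
Lemma dual_basis_vectorP (j : nat) : (j < N)%N ->
  forall k : 'I_N, tnth theta k (dual_basis_vector theta j) = (k == j :> nat)%:R.
Proof.
move=> jN; rewrite /dual_basis_vector; set P := [set v | _].
suff /xgetPex : exists v, P v by apply.
pose b k : gT := vsproj g (vbasis g)`_k.
pose T : 'M[C]_N := \matrix_(i, k) tnth theta i (b k).
have Tu : T \in unitmx.
  rewrite -row_free_unit -kermx_eq0; apply/eqP/row_matrixP => i.
  rewrite row0; set u := row i _.
  have uT : u *m T = 0 by rewrite /u -row_mul mulmx_ker row0.
  apply/rowP => k; rewrite [RHS]mxE; apply: (sum_covector (c := fun k => u 0 k)) => x.
  have -> : x = \sum_(s < N) coord (vbasis g) s (vsval x) *: b s.
    apply: val_inj; rewrite /= {1}(coord_vbasis (subvsP x)) linear_sum.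
    apply: eq_bigr => s _; rewrite [RHS]linearZ /= /b vsprojK//.
    by rewrite vbasis_mem// mem_nth// size_tuple.
  under eq_bigr do rewrite linear_sum mulr_sumr.
  rewrite exchange_big big1// => s _ /=.
  have /rowP/(_ s) := uT; rewrite !mxE => us.
  transitivity (coord (vbasis g) s (vsval x) * \sum_t u 0 t * T t s); last first.
    by rewrite us mulr0.
  rewrite mulr_sumr; apply: eq_bigr => t _.
  by rewrite [T t s]mxE linearZ /= mulrCA.
exists (\sum_s (invmx T) s (Ordinal jN) *: b s) => k.
have /matrixP/(_ k (Ordinal jN)) := mulmxV Tu; rewrite !mxE => <-.
by rewrite linear_sum; apply: eq_bigr => s _; rewrite [T k s]mxE linearZ /= mulrC.
Qed.

Lemma partial_derivative_polyfun q (j : nat) (y : gT) :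
  partial_derivative theta (polyfun q) j y =
  dgpoly q (vsval y) (vsval (dual_basis_vector theta j)).
Proof.
rewrite /partial_derivative; set e := dual_basis_vector theta j.
have -> : (fun t => polyfun q (y + t *: e)) =
    (fun t => gpoly q (vsval y + t *: vsval e)).
  by apply/funext => t; rewrite /gpoly -linearZ -linearD vsvalK.
by rewrite derive1_gpoly scale0r addr0.
Qed.

End DualBasis.

Section Independence.
Context {R : realType} {n : nat}.
Local Notation C := (Cplx R).
Local Notation M := 'M[C]_n.
Variables (g : {vspace M}) (r : nat).
Local Notation gT := (subvs_of g).
Local Notation N := (\dim g).
Variables (theta : N.-tuple (covector g)) (q : 'I_r -> mpoly.mpoly N C).
Hypotheses (htheta : basis_of fullv theta) (rN : (r <= N)%N).

Definition component_mpoly (i : 'I_N) : mpoly.mpoly N C :=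
  if insub (i : nat) is Some k then q k else linear_mpoly (tnth theta i).

Lemma gpoly_component_mpoly f i p : (forall k, f k = polyfun (q k)) ->
  gpoly (component_mpoly i) (Phi p) = Phi_component f theta i p.
Proof.
move=> fq; rewrite /component_mpoly /Phi_component.
by case: insubP => [k _ _|_]; rewrite ?fq// gpoly_linear_mpoly.
Qed.

(** The polynomial whose value at [y] is the determinant assumed to be nonzero. *)
Definition jacobian_mpoly : mpoly.mpoly N C :=
  \det (\matrix_(i < r, j < r)
          dirderiv (q i) (vsval (dual_basis_vector theta j))).

Lemma gpoly_jacobian_mpoly u : gpoly jacobian_mpoly u =
  \det (\matrix_(i < r, j < r)
          dgpoly (q i) u (vsval (dual_basis_vector theta j))).
Proof.
rewrite gpolyE /jacobian_mpoly -det_map_mx; congr (\det _).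
by apply/matrixP => i j; rewrite !mxE -gpoly_dirderiv.
Qed.

(** The Jacobian is block triangular in the dual basis: on its first [r] vectors every [theta_i]
    with [r <= i] vanishes, so the invertible block kills the first [r] coefficients. Independence
    of [theta] kills the others. *)
Lemma component_independent u (c : 'I_N -> C) : gpoly jacobian_mpoly u != 0 ->
  (forall w, w \in g -> \sum_i c i * dgpoly (component_mpoly i) u w = 0) ->
  forall i, c i = 0.
Proof.
rewrite gpoly_jacobian_mpoly => J0 c0.
set A := \matrix_(i, j) _ in J0.
have dtheta (i : 'I_N) x : (r <= i)%N ->
    dgpoly (component_mpoly i) u (vsval x) = tnth theta i x.
  move=> ri; rewrite /component_mpoly insubN -?leqNgt//.
  by rewrite dgpoly_linear_mpoly vsvalK.
have dq (k : 'I_r) : component_mpoly (widen_ord rN k) = q k.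
  by rewrite /component_mpoly (valK k : insub (widen_ord rN k : nat) = Some k).
have cr k : c (widen_ord rN k) = 0.
  pose c' : 'rV[C]_r := \row_k c (widen_ord rN k).
  have Au : A \in unitmx by rewrite unitmxE unitfE.
  have cA : c' *m A = 0.
    apply/rowP => j; rewrite !mxE.
    have := c0 _ (subvsP (dual_basis_vector theta j)).
    rewrite (bigID (fun i : 'I_N => (i < r)%N)) /= [X in _ + X]big1 ?addr0.
      rewrite big_ord_narrow => s0; rewrite -[RHS]s0.
      by apply: eq_bigr => i _; rewrite !mxE dq.
    move=> i; rewrite -leqNgt => ri; rewrite dtheta// dual_basis_vectorP//.
      by rewrite gtn_eqF ?mulr0// (leq_trans (ltn_ord j)).
    exact: leq_trans (ltn_ord j) rN.
  have : c' 0 k = 0 by rewrite -[c'](mulmxK Au) cA mul0mx mxE.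
  by rewrite mxE.
apply: (sum_covector htheta) => x; rewrite -[RHS](c0 _ (subvsP x)).
apply: eq_bigr => i _; have [ri|ir] := leqP r i; first by rewrite dtheta.
have -> : i = widen_ord rN (Ordinal ir) by exact: val_inj.
by rewrite cr !mul0r.
Qed.

End Independence.

(** * The integrable system *)

Theorem theorem15 (R : realType) (n : nat)
    (G : set 'M[Cplx R]_n) (g : {vspace 'M[Cplx R]_n}) (r : nat)
    (hG : linear_algebraic_group G) (hsc : simply_connected G)
    (hg : lie_algebra_of G g) (hss : semisimple_lie_algebra g)
    (hr : group_rank G r)
    (Oreg : set 'M[Cplx R]_n) (hO : regular_nilpotent_orbit G g r Oreg)
    (xi h eta : 'M[Cplx R]_n) (hsl2 : sl2_triple g xi h eta)
    (hxi : Oreg xi) (heta : Oreg eta)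
    (f : 'I_r -> subvs_of g -> Cplx R)
    (hf : homogeneous_free_generators G f)
    (y : subvs_of g) (hy : regular g r (vsval y))
    (theta : (\dim g).-tuple (covector g)) (htheta : basis_of fullv theta)
    (hdet : \det (\matrix_(i < r, j < r) partial_derivative theta (f i) j y)
              != 0) :
  integrable_system (G `*` slodowy_slice g xi eta) (phase_tangent g eta)
    (phase_form g) (\dim g + r) r (Phi_component f theta).
Proof.
have gs := lie_algebra_subalgebra hG hg.
have [_ regO] := hO.
have [[_ nil_xi] [_ rxi]] := regO _ hxi.
have [_ [_ reta]] := regO _ heta.
have [[xig _ _] _ _ _] := hsl2.
have rN : (r <= \dim g)%N by rewrite -reta dimvS// capvSl.
have [cG _] := hsc.
have [finv _ _ _] := hf.
have [q qf] := choice (fun i => proj1 (finv i)).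
have [delta [pdelta delta_xi transv]] :=
  slice_transversality gs hsl2 nil_xi rxi reta.
pose Q := component_mpoly theta q.
(* The single point [y] of [g] where the Jacobian is nonzero feeds the density argument. *)
have Jy : gpoly (jacobian_mpoly theta q) (vsval y) != 0.
  rewrite gpoly_jacobian_mpoly.
  rewrite (_ : \matrix_(i, j) _ = \matrix_(i, j) partial_derivative theta (f i) j y)//.
  by apply/matrixP => i j; rewrite !mxE qf partial_derivative_polyfun.
have unitX p : (G `*` slodowy_slice g xi eta) p -> p.1 \in unitmx.
  by case=> Gp _; apply: (group_unitmx hG).
have gX p : (G `*` slodowy_slice g xi eta) p -> p.2 \in g.
  by case=> _ Sp; apply: slice_mem Sp.
split.
- by move=> p Xp; rewrite dim_phase_tangent ?unitX// reta.
- by rewrite -addnn leq_add2r.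
- by rewrite addnK.
exists (fun i p => linfun (dcomponent (Q i) p)); split.
- move=> i p Xp.
  have -> : Phi_component f theta i = fun p => gpoly (Q i) (Phi p).
    by apply/funext => p'; rewrite (gpoly_component_mpoly _ _ _ qf).
  exact/component_is_differential/unitX.
- move=> i j p ir Xp; have [Gp Sp] := Xp.
  have ham k := component_hamiltonian eta (Q k) gs hss (unitX p Xp) (gX p Xp)
    (fun z => conj_mem hG hg Gp).
  have [u1 [u1g H1 inv1]] := ham i; have [u2 [u2g H2 _]] := ham j.
  exists (u1 *m p.1, 0), (u2 *m p.1, 0); split=> //.
  rewrite /phase_form /= !mulmxK ?unitX// !killing0r subr0 sub0r.
  rewrite -killing_lie ?gX// inv1 ?lie0l; last first.
    move=> z zg; rewrite /Q /component_mpoly insubT.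
    apply: (invariant_differential hG hg) => //; last first.
      by rewrite PhiE memvN (conj_mem hG hg) ?gX.
    by rewrite -qf.
  by rewrite /killing big1 ?oppr0// => s _; rewrite lie0l linear0.
exists [set p | p.1 \in unitmx /\
  delta p.2 * gpoly (jacobian_mpoly theta q) (Phi p) != 0]; split.
- exact: Phi_nonvanishing_open.
- apply: Phi_nonvanishing_dense => //; exists (vsval y) => //; exact: subvsP.
move=> [a x] [/= Ga Sx] [_]; rewrite mulf_eq0 negb_or => /andP[dx J0] c c0.
apply: (component_independent htheta rN J0) => w wg.
(* Every [w] in [g] is the image of a tangent vector, so a relation on the tangent space descends to
   one on [g]. *)
have [v vT vw] := dPhi_surjective hG hg xig transv Ga Sx dx wg.
rewrite -[RHS](c0 _ vT); apply: eq_bigr => i _.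
by rewrite lfunE /= /dcomponent vw.
Qed.
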